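(* Let $\bm X=(X_1,\dots,X_p)^T$ be a random vector with mean $(\mu_1,\dots,\mu_p)^T$, covariance matrix $\Sigma_0=(\sigma^0_{ij})$ and precision matrix $\Omega_0=\Sigma_0^{-1}$, and let $\bm X_1,\dots,\bm X_n$ be i.i.d. samples of $\bm X$ with sample covariance matrix $\Sigma_n$. Suppose $\Omega_0\in U(q,s_0(p))$ with $0\le q<1$, where $$U(q,s_0(p))=\Big\{\Omega=(\omega_{ij}):\ \Omega\succ 0,\ \|\Omega\|_{L_1}\le M,\ \max_{1\le i\le p}\sum_{j=1}^p|\omega_{ij}|^q\le s_0(p)\Big\}.$$ Let $\rho\ge 1$ and let $\hat\Omega$ be the (symmetrized) GISS$^\rho$ estimator computed from $\Sigma_n$ with stopping tolerance $\lambda_n$. (1) Assume (exponential-type tails) that there exists $0<\eta<1/4$ such that $\log p/n\le\eta$ and, for some constant $K<\infty$, $\mathrm{E}\,e^{t(X_i-\mu_i)^2}\le K$ for all $|t|\le\eta$ and all $i$. Let $\tau>0$, $C_0=2\eta^{-2}(2+\tau+\eta^{-1}e^2K^2)^2$, and $\lambda_n=C_0M\sqrt{\frac{\log p}{n}}<\frac1p-\varrho$ for some $\varrho>0$. Then, with probability at least $1-4p^{-\tau}$, $$|\hat\Omega-\Omega_0|_\infty\le C_0\left(3+\frac{1+3p\lambda_n}{1-p\lambda_n}\right)M^2\sqrt{\frac{\log p}{n}}.$$ (2) Assume (polynomial-type tails) that for some $\tilde\gamma,c_1>0$ one has $p\le c_1n^{\tilde\gamma}$ and that for some $\delta>0$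 and some constant $K$, $\mathrm{E}|X_i-\mu_i|^{4\tilde\gamma+4+\delta}\le K$ for all $i$. Let $\tau>0$, $\kappa=\max_{i,j}\mathrm{E}[(X_i-\mu_i)(X_j-\mu_j)-\sigma^0_{ij}]^2$, $D_0=\sqrt{(5+\tau)(\kappa+1)}$, and $\lambda_n=D_0M\sqrt{\frac{\log p}{n}}<\frac1p-\varrho$ for some $\varrho>0$. Then, with probability at least $1-O\left(n^{-\delta/8}+p^{-\tau/2}\right)$, $$|\hat\Omega-\Omega_0|_\infty\le D_0\left(3+\frac{1+3p\lambda_n}{1-p\lambda_n}\right)M^2\sqrt{\frac{\log p}{n}}.$$
   Context: Norms: for a matrix $A=(a_{ij})\in\mathbb{R}^{p\times p}$, $|A|_\infty=\max_{i,j}|a_{ij}|$ and $\|A\|_{L_1}=\max_{j}\sum_{i}|a_{ij}|$; for a vector $a$, $|a|_\infty=\max_j|a_j|$, $|a|_1=\sum_j|a_j|$, $|a|_2$ is the Euclidean norm. $A\succ0$ means positive definite. For $q=0$, $|\omega|^0$ is $1$ if $\omega\neq0$ and $0$ otherwise. Sample covariance: $\Sigma_n=\frac1{n-1}\sum_{k=1}^n(\bm X_k-\bar{\bm X})(\bm X_k-\bar{\bm X})^T$, $\bar{\bm X}=\frac1n\sum_k\bm X_k$. The dimension $p$ (and $M$) may depend on $n$; $O(\cdot)$ is as $n$ grows. GISS$^\rho$ algorithm with matrix $A\in\mathbb{R}^{p\times p}$, right-hand side $\bm e\in\mathbb{R}^p$, acceleration factor $\rho\ge1$ and tolerance $\lambda\ge0$.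 Initialize $\bm r_0=\bm e$, $t_1=1/|A^T\bm r_0|_\infty$, $\bm p(t_1)=t_1A^T\bm r_0$, $\tilde{\bm p}(t_1)=\bm p(t_1)$. For $k=1,2,\dots$, while the current residual satisfies $|\bm r|_\infty>\lambda$, do: 1. $I_k=\{i: |\tilde{\bm p}_i(t_k)|=1\}$. 2. $\bm\beta(t_k)$ is a minimizer of $|AP_{I_k}\bm\beta-\bm e|_2^2$, where $P_{I_k}$ is the coordinate projection onto the indices $I_k$ (so $\bm\beta(t_k)$ is supported on $I_k$). 3. $\bm r_k=\bm e-A\bm\beta(t_k)$. 4. $t_{k+1}=\rho\min\{t: t>t_k,\ \exists j:\ |\bm p_j(t)|=1,\ \bm\beta_j(t_k)=0,\ \bm p_j(t)\ne\bm p_j(t_k)\}$, where $\bm p_j(t)=\bm p_j(t_k)+(t-t_k)(A^T\bm r_k)_j$. 5. Set $\bm p(t_{k+1})$ by this formula with $t=t_{k+1}$, and $\tilde{\bm p}(t_{k+1})=\mathrm{sign}(\bm p(t_{k+1}))\min(|\bm p(t_{k+1})|,1)$ componentwise. The output is the last $\bm\beta(t_k)$, which satisfies $|A\bm\beta(t_k)-\bm e|_\infty\le\lambda$. GISS$^\rho$ estimator computed from $A$ with tolerance $\lambda$: for each $i=1,\dots,p$ let $\bm\beta_i$ be the output for right-hand side the $i$-th standard unit vector $\bm e_i$; let $\hat\Omega^1=(\omega_{ij})=[\bm\beta_1,\dots,\bm\beta_p]$; the estimator is the symmetrization $\hat\Omega=(\hat\omega_{ij})$ with $\hat\omega_{ij}=\hat\omega_{ji}=\omega_{ij}\mathbb{I}(|\omega_{ij}|\le|\omega_{ji}|)+\omega_{ji}\mathbb{I}(|\omega_{ij}|>|\omega_{ji}|)$,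 where $\mathbb{I}$ is the indicator function. *)

(* Defs.v *)
From HB Require Import structures.
From mathcomp Require Import all_boot all_order all_algebra.
From mathcomp Require Import all_classical all_reals all_analysis.

Set Implicit Arguments.
Unset Strict Implicit.
Unset Printing Implicit Defensive.

Import Order.TTheory GRing.Theory Num.Theory.
Import numFieldNormedType.Exports.

Local Open Scope classical_set_scope.
Local Open Scope ring_scope.

(* The library norm [`|A|] on ['M[R]_(m, n)] is the entrywise maximum norm
   (see [mx_normrE]): it is the norm |.|_oo of matrices and of column vectors. *)

Section Matrices.
Variable R : realType.

Definition norm_L1 m n (A : 'M[R]_(m, n)) : R :=
  \big[Num.max/0]_(j < n) \sum_(i < m) `|A i j|.

Definition sqnorm2 p (v : 'cV[R]_p) : R := \sum_(i < p) v i 0 ^+ 2.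

Definition posdefmx p (A : 'M[R]_p) : Prop :=
  A^T = A /\ forall v : 'cV[R]_p, v != 0 -> 0 < (v^T *m A *m v) 0 0.

(* |x|^q with the convention 0^0 = 0 (whereas [powR] has [0 `^ 0 = 1]). *)
Definition powabs (q x : R) : R := if x == 0 then 0 else `|x| `^ q.

Definition class_U p (q s0 M : R) (Omega : 'M[R]_p) : Prop :=
  [/\ posdefmx Omega,
      norm_L1 Omega <= M
    & \big[Num.max/0]_(i < p) \sum_(j < p) powabs q (Omega i j) <= s0].

Definition sample_mean n p (x : 'I_n -> 'cV[R]_p) : 'cV[R]_p :=
  n%:R^-1 *: \sum_(k < n) x k.

Definition sample_cov n p (x : 'I_n -> 'cV[R]_p) : 'M[R]_p :=
  n.-1%:R^-1 *:
    \sum_(k < n) (x k - sample_mean x) *m (x k - sample_mean x)^T.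

End Matrices.

Section GISS.
Variables (R : realType) (p : nat).
Variables (rho : R) (A : 'M[R]_p) (lambda : R).

(* The componentwise truncation written with a tilde. *)
Definition truncate (v : 'cV[R]_p) : 'cV[R]_p :=
  \col_i (Num.sg (v i 0) * Num.min `|v i 0| 1).

Definition active_set (v : 'cV[R]_p) : {set 'I_p} :=
  [set i | `|truncate v i 0| == 1]%SET.

Definition coord_proj (I : {set 'I_p}) : 'M[R]_p :=
  diag_mx (\row_i (i \in I)%:R).

(* b is supported on I and minimizes |A P_I b - e|_2^2; the minimizer need not
   be unique, so this is a relation. *)
Definition restricted_lsq (e : 'cV[R]_p) (I : {set 'I_p}) (b : 'cV[R]_p) :=
  coord_proj I *m b = b /\
  forall c : 'cV[R]_p,
    sqnorm2 (A *m coord_proj I *m b - e) <= sqnorm2 (A *m coord_proj I *m c - e).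

(* p(t) = p(t_k) + (t - t_k) A^T r_k. *)
Definition flow (tk : R) (pk r : 'cV[R]_p) (t : R) : 'cV[R]_p :=
  pk + (t - tk) *: (A^T *m r).

Definition crossing_times (tk : R) (pk b r : 'cV[R]_p) : set R :=
  [set t | tk < t /\ exists j : 'I_p,
     [/\ `|flow tk pk r t j 0| = 1, b j 0 = 0 & flow tk pk r t j 0 <> pk j 0]].

Definition is_minimum (S : set R) (m : R) : Prop := S m /\ lbound S m.

(* A run that stops after N iterations, with t k = t_k, v k = p(t_k),
   b k = beta(t_k) and r k = r_k.  The value t_{N+1} is never used once the
   residual r_N has passed the test, so its existence is not required.
   If already |e|_oo <= lambda, then no iteration takes place (N = 0) and the
   output is 0, the coefficient vector whose residual is r_0 = e.
   When the set of crossing times is empty, the run cannot be continued: for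
   some inputs there is no run at all. *)
Record giss_run (e : 'cV[R]_p) (N : nat)
    (t : nat -> R) (v b r : nat -> 'cV[R]_p) : Prop := GissRun {
  run_b0 : b 0%N = 0;
  run_r0 : r 0%N = e;
  run_t1 : t 1%N = 1 / `|A^T *m r 0%N|;
  run_v1 : v 1%N = t 1%N *: (A^T *m r 0%N);
  run_loop : forall k, (1 <= k <= N)%N -> lambda < `|r k.-1|;
  run_b : forall k, (1 <= k <= N)%N -> restricted_lsq e (active_set (v k)) (b k);
  run_r : forall k, (1 <= k <= N)%N -> r k = e - A *m b k;
  run_t : forall k, (1 <= k < N)%N ->
    exists2 s, is_minimum (crossing_times (t k) (v k) (b k) (r k)) s
             & t k.+1 = rho * s;
  run_v : forall k, (1 <= k < N)%N ->
    v k.+1 = flow (t k) (v k) (r k) (t k.+1);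
  run_stop : `|r N| <= lambda }.

Definition giss_output (e beta : 'cV[R]_p) : Prop :=
  exists N t v b r, giss_run e N t v b r /\ beta = b N.

(* The formula is applied to the pairs i <= j and reflected.  The order matters
   only if w_ij = - w_ji <> 0, where the formulas for (i, j) and (j, i)
   disagree. *)
Definition symmetrize (W : 'M[R]_p) : 'M[R]_p :=
  let pick i j := if `|W i j| <= `|W j i| then W i j else W j i in
  \matrix_(i, j) if (i <= j)%N then pick i j else pick j i.

Definition giss_estimator (Omega : 'M[R]_p) : Prop :=
  exists W : 'M[R]_p,
    (forall i : 'I_p, giss_output (delta_mx i 0) (col i W)) /\
    Omega = symmetrize W.

End GISS.

Section Probability.
Context {d : measure_display} {T : measurableType d} {R : realType}.
Variable P : probability T R.

Definition independent_rvs n d' (T' : measurableType d')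
    (X : 'I_n -> {RV P >-> T'}) : Prop :=
  forall (J : {set 'I_n}) (B : 'I_n -> set T'),
    (forall k, measurable (B k)) ->
    P (\bigcap_(k in [set` J]) (X k @^-1` B k)) =
    (\prod_(k in J) P (X k @^-1` B k))%E.

Definition iid_samples n d' (T' : measurableType d')
    (X : {RV P >-> T'}) (Xs : 'I_n -> {RV P >-> T'}) : Prop :=
  independent_rvs Xs /\
  forall k (B : set T'), measurable B ->
    distribution P (Xs k) B = distribution P X B.

Definition rv_coord p (X : T -> p.-tuple R) (i : 'I_p) : T -> R :=
  fun w => tnth (X w) i.

Definition has_mean_cov p (X : T -> p.-tuple R)
    (mu : 'I_p -> R) (Sigma : 'M[R]_p) : Prop :=
  [/\ forall i, rv_coord X i \in Lfun P 2%:E,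
      forall i, 'E_P[rv_coord X i]%E = (mu i)%:E
    & forall i j, covariance P (rv_coord X i) (rv_coord X j) = (Sigma i j)%:E].

Definition sample_cov_rv n p (Xs : 'I_n -> T -> p.-tuple R) (w : T) : 'M[R]_p :=
  sample_cov (fun k => \col_i rv_coord (Xs k) i w).

(* max_{i,j} E[(X_i - mu_i)(X_j - mu_j) - sigma_ij]^2; [fine] is harmless when
   the fourth moments are finite. *)
Definition kappa p (X : T -> p.-tuple R)
    (mu : 'I_p -> R) (Sigma : 'M[R]_p) : R :=
  \big[Num.max/0]_(ij : 'I_p * 'I_p)
    fine 'E_P[(fun w => ((rv_coord X ij.1 w - mu ij.1) * (rv_coord X ij.2 w - mu ij.2)
                         - Sigma ij.1 ij.2) ^+ 2)%R]%E.

(* "G holds with probability at least c", for a G not known to be measurable. *)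
Definition prob_at_least (c : R) (G : set T) : Prop :=
  exists E : set T, [/\ measurable E, E `<=` G & (c%:E <= P E)%E].

(* The assumptions shared by both tail conditions; Omega_0 is
   [invmx Sigma0]. *)
Record giss_setting n p (X : {RV P >-> p.-tuple R})
    (Xs : 'I_n -> {RV P >-> p.-tuple R}) (mu : 'I_p -> R) (Sigma0 : 'M[R]_p)
    (q s0 M rho : R) : Prop := GissSetting {
  setting_n : (2 <= n)%N;
  setting_p : (1 <= p)%N;
  setting_X : has_mean_cov X mu Sigma0;
  setting_iid : iid_samples X Xs;
  setting_unit : Sigma0 \in unitmx;
  setting_q : 0 <= q < 1;
  setting_U : class_U q s0 M (invmx Sigma0);
  setting_rho : 1 <= rho }.

(* The estimator computed from Sigma_n exists and every admissible choice of it
   is within eps of Omega0. *)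
Definition giss_within n p (Xs : 'I_n -> {RV P >-> p.-tuple R})
    (rho lambda eps : R) (Omega0 : 'M[R]_p) : set T :=
  [set w | (exists Omega, giss_estimator rho (sample_cov_rv Xs w) lambda Omega) /\
     forall Omega, giss_estimator rho (sample_cov_rv Xs w) lambda Omega ->
       `|Omega - Omega0| <= eps].

End Probability.

(* Main.v *)
(** Let [u] bound the entries of [Sigma_n - Sigma_0] and [lambda = M u], with
    [p lambda < 1].  Then [Sigma_n Omega_0] differs from the identity by at most
    [lambda < 1/p] entrywise, so [Sigma_n] is invertible.  In each GISS step the
    gradient [A^T r] vanishes on the active set, hence a nonzero residual pushes
    some inactive coordinate across +-1; the active set grows strictly and the
    run stops within [p] steps.  For a terminal [W], writing
    [W - Omega_0 = Omega_0 ((Sigma_n W - 1) - (Sigma_n - Sigma_0) W)] and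
    [|W|_L1 <= M + p |W - Omega_0|_oo] gives
    [|W - Omega_0|_oo <= 2 M lambda / (1 - p lambda)], half of the claimed bound.

    It remains to bound [|Sigma_n - Sigma_0|_oo].  Under exponential tails this
    is Chernoff's bound for the averages of [Y_i Y_j] and [Y_i], [Y = X - mu],
    with exponent proportional to [sqrt (ln p / n)].  Under polynomial tails the
    coordinates are truncated at [Y_i^2 <= b = n^(1/2 - eps)], with
    [eps m = delta / 8] and [m = 2 gam + 2 + delta / 2]: the truncation fails with
    probability [O(n^(-delta/8))], its bias is [o(n^(-1/2))], and the second order
    exponential inequality gives the Gaussian exponent [(4 + tau) / 2] for the
    threshold [sqrt ((4 + tau)(kappa + 1) ln p / n)]; the gap between [4 + tau]
    and [5 + tau] absorbs all lower order terms once [n] is large. *)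

Require Import Defs.
From HB Require Import structures.
From mathcomp Require Import all_boot all_order all_algebra.
From mathcomp Require Import all_classical all_reals all_analysis.
From mathcomp Require Import measurable_realfun ring lra.

Set Implicit Arguments.
Unset Strict Implicit.
Unset Printing Implicit Defensive.

Import Order.TTheory GRing.Theory Num.Theory.
Import numFieldNormedType.Exports.
Local Open Scope classical_set_scope.
Local Open Scope ring_scope.

(** * Perturbation of the inverse *)

Section MatrixNorms.
Variable R : realType.

Lemma mx_norm_leP m n (A : 'M[R]_(m, n)) (c : R) : 0 <= c ->
  (`|A| <= c) <-> (forall i j, `|A i j| <= c).
Proof.
move=> c0; rewrite [X in X <= c]/Num.Def.normr/= mx_normrE; split => [Ac i j|Ac].
  by apply: le_trans Ac; rewrite (le_bigmax _ (fun ij => `|A ij.1 ij.2|) (i, j)).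
by apply: bigmax_le => // ij _; exact: Ac.
Qed.

Lemma ler_mx_norm m n (A : 'M[R]_(m, n)) i j : `|A i j| <= `|A|.
Proof. by have /mx_norm_leP := lexx `|A|; apply. Qed.

Lemma ler_col_norm_L1 m n (A : 'M[R]_(m, n)) j :
  \sum_i `|A i j| <= norm_L1 A.
Proof. by rewrite /norm_L1 (le_bigmax _ (fun j => \sum_i `|A i j|) j). Qed.

Lemma ler_mulmx_entry m n k (A : 'M[R]_(m, n)) (B : 'M[R]_(n, k)) (c : R) i j :
  (forall l, `|A i l| <= c) ->
  `|(A *m B) i j| <= c * \sum_l `|B l j|.
Proof.
move=> Ac; rewrite mxE mulr_sumr; apply: (le_trans (ler_norm_sum _ _ _)).
by apply: ler_sum => l _; rewrite normrM ler_wpM2r.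
Qed.

(** A left null vector [u] of [B] satisfies [u = - u (B - 1)], so [|u| <= p c |u|] in the maximum
    norm, which forces [u = 0]. *)
Lemma unitmx_near1 p (B : 'M[R]_p) (c : R) :
  `|B - 1%:M| <= c -> p%:R * c < 1 -> B \in unitmx.
Proof.
move=> Bc pc; rewrite -row_free_unit -kermx_eq0; apply/eqP/row_matrixP => i.
rewrite row0; set u := row i (kermx B).
have uB : u *m B = 0 by rewrite -row_mul mulmx_ker row0.
have c0 : 0 <= c by exact: le_trans Bc.
have uE : u = - (u *m (B - 1%:M)) by rewrite mulmxBr uB mulmx1 sub0r opprK.
have key : `|u| <= p%:R * c * `|u|.
  apply/mx_norm_leP => [|k j]; first by rewrite !mulr_ge0.
  rewrite {1}uE mxE normrN.
  apply: (le_trans (@ler_mulmx_entry _ _ _ _ _ `|u| _ _ _)) => [l|].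
    exact: ler_mx_norm.
  rewrite mulrC ler_wpM2r//.
  apply: (@le_trans _ _ (\sum_(l < p) c)); last first.
    by rewrite sumr_const card_ord mulr_natl.
  by apply: ler_sum => l _; exact: (le_trans (ler_mx_norm _ _ _)).
apply/eqP; rewrite -normr_eq0 eq_le normr_ge0 andbT.
by rewrite leNgt; apply/negP => u0; move: key; rewrite leNgt gtr_pMl ?pc.
Qed.

End MatrixNorms.

Section Perturbation.
Variables (R : realType) (p : nat) (S S0 W : 'M[R]_p) (M eps lam : R).
Hypothesis S0_unit : S0 \in unitmx.
Hypothesis S0_sym : (invmx S0)^T = invmx S0.
Hypothesis S0_L1 : norm_L1 (invmx S0) <= M.
Hypothesis SS0 : `|S - S0| <= eps.
Hypothesis lamE : lam = M * eps.
Hypothesis plam : p%:R * lam < 1.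

Let M0 : 0 <= M.
Proof. by apply: le_trans S0_L1; rewrite /norm_L1; apply: bigmax_ge_id. Qed.

Let eps0 : 0 <= eps. Proof. exact: le_trans SS0. Qed.

Lemma perturbed_unitmx : S \in unitmx.
Proof.
suff : S *m invmx S0 \in unitmx by rewrite unitmx_mul => /andP[].
apply: (@unitmx_near1 _ _ _ lam) => //.
rewrite -(mulmxV S0_unit) -mulmxBl.
apply/mx_norm_leP => [|i j]; first by rewrite lamE mulr_ge0.
apply: (le_trans (@ler_mulmx_entry _ _ _ _ _ _ eps _ _ _)) => [l|].
  by apply: le_trans SS0; exact: ler_mx_norm.
by rewrite lamE mulrC ler_wpM2r// (le_trans (ler_col_norm_L1 _ _)).
Qed.

Lemma approx_inverse_error : `|S *m W - 1%:M| <= lam ->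
  `|W - invmx S0| <= 2 * M * lam / (1 - p%:R * lam).
Proof.
move=> SW; move: S0_sym S0_L1; set O := invmx S0 => O_sym O_L1.
have WO : W - O = O *m ((S *m W - 1%:M) - (S - S0) *m W).
  have -> : S *m W - 1%:M - (S - S0) *m W = S0 *m W - 1%:M.
    by rewrite mulmxBl opprB addrC addrA subrK.
  by rewrite mulmxBr mulmx1 mulmxA mulVmx// mul1mx.
have lam0 : 0 <= lam by exact: le_trans SW.
have d0 : 0 < 1 - p%:R * lam by rewrite subr_gt0.
set D := `|W - O|.
have Wcol j : \sum_l `|W l j| <= M + p%:R * D.
  apply: (@le_trans _ _ (\sum_l (`|O l j| + D))).
    apply: ler_sum => l _; rewrite -{1}(subrK (O l j) (W l j)) addrC.
    apply: (le_trans (ler_normD _ _)); rewrite lerD2l.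
    by have := ler_mx_norm (W - O) l j; rewrite !mxE.
  rewrite big_split/= sumr_const card_ord mulr_natl lerD2r.
  exact: (le_trans (ler_col_norm_L1 _ _)).
(* [norm_L1] controls column sums; the symmetry of [O] turns this into a bound on row sums. *)
have Orow i : \sum_k `|O i k| <= M.
  rewrite -[in leLHS]O_sym; under eq_bigr do rewrite mxE.
  exact: (le_trans (ler_col_norm_L1 _ _)).
have D0 : 0 <= D by exact: normr_ge0.
(* [D] occurs on both sides: since [M eps = lam], the right-hand side is [2 M lam + p lam D], and
   [p lam < 1] allows solving for [D]. *)
have key : D <= M * (lam + eps * (M + p%:R * D)).
  apply/mx_norm_leP => [|i j].
    by rewrite mulr_ge0// addr_ge0// mulr_ge0// addr_ge0// mulr_ge0.
  rewrite {1}WO mxE.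
  set e1 := lam + _.
  apply: (@le_trans _ _ (\sum_k `|O i k| * e1)).
    apply: (le_trans (ler_norm_sum _ _ _)); apply: ler_sum => k _.
    rewrite normrM ler_wpM2l// mxE.
    apply: (le_trans (ler_normD _ _)); apply: lerD.
      by apply: le_trans SW; exact: ler_mx_norm.
    rewrite mxE normrN.
    apply: (le_trans (@ler_mulmx_entry _ _ _ _ _ _ eps _ _ _)) => [l|].
      by apply: le_trans SS0; exact: ler_mx_norm.
    by rewrite ler_wpM2l.
  rewrite -mulr_suml ler_wpM2r// /e1 addr_ge0// mulr_ge0// addr_ge0//.
  by rewrite mulr_ge0.
rewrite ler_pdivlMr//; move: key; rewrite lamE; lra.
Qed.

End Perturbation.

(** * GISS runs *)

Section GissRun.
Variables (R : realType) (p : nat).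
Implicit Types (A : 'M[R]_p) (v b e : 'cV[R]_p) (I : {set 'I_p}).

Lemma sqnorm2_mulmx v : sqnorm2 v = (v^T *m v) 0 0.
Proof. by rewrite mxE; apply: eq_bigr => i _; rewrite mxE expr2. Qed.

Lemma sqnorm2_ge0 v : 0 <= sqnorm2 v.
Proof. by apply: sumr_ge0 => i _; exact: sqr_ge0. Qed.

Lemma sqnorm2_eq0 v : sqnorm2 v = 0 -> v = 0.
Proof.
move=> /eqP; rewrite psumr_eq0 => [/allP v0|i _]; last exact: sqr_ge0.
apply/colP => i; rewrite mxE; apply/eqP.
by rewrite -sqrf_eq0; apply: v0; rewrite mem_index_enum.
Qed.

Lemma sqnorm2D v w :
  sqnorm2 (v + w) = sqnorm2 v + 2 * (w^T *m v) 0 0 + sqnorm2 w.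
Proof.
rewrite mxE mulr_sumr -!big_split/=; apply: eq_bigr => i _.
by rewrite !mxE; ring.
Qed.

Lemma col_mulmx m n k (B : 'M[R]_(m, n)) (C : 'M[R]_(n, k)) j :
  col j (B *m C) = B *m col j C.
Proof. by rewrite !colE mulmxA. Qed.

Lemma coord_proj_tr I : (coord_proj R I)^T = coord_proj R I.
Proof. by rewrite /coord_proj tr_diag_mx. Qed.

Lemma coord_projE I v i : (coord_proj R I *m v) i 0 = (i \in I)%:R * v i 0.
Proof. by rewrite /coord_proj mul_diag_mx !mxE. Qed.

Lemma coord_proj_idem I :
  coord_proj R I *m coord_proj R I = coord_proj R I.
Proof.
apply/matrixP => i j; rewrite mul_diag_mx !mxE.
by case: (i \in I); rewrite ?mul1r// mul0r mul0rn.
Qed.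

(* The operator P A^T A P + (1 - P) is positive definite as soon as A is
   injective, and its inverse solves the normal equations on the range of P. *)
Lemma restricted_lsq_exists A e I : A \in unitmx ->
  exists b, restricted_lsq A e I b /\
    forall i, i \in I -> (A^T *m (e - A *m b)) i 0 = 0.
Proof.
move=> uA; set P := coord_proj R I.
have PE v i : (P *m v) i 0 = (i \in I)%:R * v i 0 by exact: coord_projE.
pose G := P *m A^T *m A *m P + (1%:M - P).
(* If [G w = 0], then [P G w = 0] gives [|A P w|^2 = 0], so [P w = 0] because [A] is invertible, and
   [G w] reduces to [w]. *)
have uG : G \in unitmx.
  rewrite -unitmx_tr -row_free_unit -kermx_eq0; apply/eqP/row_matrixP => i.
  rewrite row0; set u := row i _; pose w := u^T.
  have Gw : G *m w = 0.
    apply: trmx_inj; rewrite trmx_mul trmxK -row_mul mulmx_ker row0.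
    by rewrite trmx0.
  have PG : P *m G = P *m A^T *m A *m P.
    rewrite mulmxDr mulmxBr mulmx1 /P coord_proj_idem subrr addr0.
    by rewrite !mulmxA coord_proj_idem.
  have APw : A *m P *m w = 0.
    apply: sqnorm2_eq0; rewrite sqnorm2_mulmx !trmx_mul coord_proj_tr -/P.
    by rewrite !mulmxA -!(mulmxA w^T) -PG -!mulmxA Gw !mulmx0 mxE.
  have Pw : P *m w = 0.
    by rewrite -[LHS](mulKmx uA) (mulmxA A) APw mulmx0.
  have : w = 0.
    move: Gw; rewrite mulmxDl -!mulmxA Pw !mulmx0 add0r mulmxBl mul1mx Pw.
    by rewrite subr0.
  by rewrite /w => /(congr1 trmx); rewrite trmxK trmx0.
pose b := invmx G *m (P *m A^T *m e).
have Gb : G *m b = P *m A^T *m e by rewrite mulKVmx.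
(* Outside [I] the equation [G b = P A^T e] reads [b i = 0]. *)
have Pb : P *m b = b.
  apply/colP => i; have /colP/(_ i) := Gb.
  rewrite mulmxDl mulmxBl mul1mx -!mulmxA [LHS]mxE [X in _ + X]mxE.
  rewrite [X in _ + (_ + X)]mxE !PE.
  case: (i \in I); rewrite ?mul1r// !mul0r subr0 add0r.
  by move=> ->.
have grad i : i \in I -> (A^T *m (e - A *m b)) i 0 = 0.
  move=> iI; have /colP/(_ i) := Gb.
  rewrite mulmxDl mulmxBl mul1mx -!mulmxA Pb subrr addr0 !PE iI !mul1r.
  by move=> h; rewrite mulmxBr [LHS]mxE [X in _ + X]mxE h subrr.
exists b; split => //; split => // c.
have -> : A *m P *m c - e = (A *m P *m b - e) + A *m P *m (c - b).
  by rewrite [in RHS]mulmxBr [RHS]addrC addrA subrK.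
(* By the normal equations [A P (c - b)] is orthogonal to the residual of [b], so the cost at [c]
   exceeds that at [b] by a square. *)
suff h : (A *m P *m (c - b))^T *m (A *m P *m b - e) = 0.
  by rewrite [leRHS]sqnorm2D h mxE mulr0 addr0 lerDl sqnorm2_ge0.
rewrite !trmx_mul coord_proj_tr -/P -!mulmxA Pb -(opprB e) !mulmxN.
rewrite (_ : P *m _ = 0) ?mulmx0 ?oppr0//.
by apply/colP => i; rewrite PE [RHS]mxE; case: (boolP (i \in I)) => iI;
  rewrite ?mul0r// mul1r grad.
Qed.

(** Truncation leaves the modulus [min(|v i|, 1)], so coordinates that overshoot 1 when [rho > 1]
    count as active. *)
Lemma in_active_set v i : (i \in active_set v) = (1 <= `|v i 0|).
Proof.
rewrite inE mxE normrM.
have [->|v0] := eqVneq (v i 0) 0.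
  by rewrite sgr0 normr0 mul0r eq_sym oner_eq0 ler10.
rewrite normr_sg v0 mul1r ger0_norm; last by rewrite le_min normr_ge0 ler01.
by rewrite minEle; case: (leP `|v i 0| 1) => [v1|v1];
  [rewrite eq_le v1|rewrite eqxx (ltW v1)].
Qed.

(** Up to a common sign, a coordinate with slope [g] moves upward at speed [|g|]; this normalizes
    the direction when moduli along the flow are compared. *)
Lemma normr_flip_sign (g x y : R) : g != 0 ->
  `|x + y * g| = `|Num.sg g * x + y * `|g| |.
Proof.
case: (ltgtP g 0) => // [g0|g0] _; last by rewrite gtr0_sg// (gtr0_norm g0) mul1r.
by rewrite ltr0_sg// (ltr0_norm g0) -normrN; congr `| _ |; ring.
Qed.

Lemma flowE A (t u : R) v r j :
  flow A t v r u j 0 = v j 0 + (u - t) * (A^T *m r) j 0.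
Proof. by rewrite mxE [X in _ + X]mxE. Qed.

Section Crossing.
Variables (A : 'M[R]_p) (t rho : R) (v b r : 'cV[R]_p).
Hypothesis grad : forall i, i \in active_set v -> (A^T *m r) i 0 = 0.
Hypothesis supp : forall i, i \notin active_set v -> b i 0 = 0.

(** Active coordinates have zero slope. Each moving coordinate starts inside (-1, 1), has
    coefficient 0 and reaches modulus 1 in finite time; the smallest of these finitely many times is
    the minimum. *)
Lemma crossing_min_exists : A^T *m r != 0 ->
  exists s, is_minimum (crossing_times A t v b r) s.
Proof.
move: grad; set g := A^T *m r => gr0 g0.
have [j0 gj0] : exists j, g j 0 != 0.
  apply/not_existsP => g0'; move/eqP: g0; apply; apply/colP => i.
  by rewrite [RHS]mxE; apply/eqP/negPn/negP; exact: g0'.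
pose J := [pred j | g j 0 != 0].
have vlt j : J j -> `|v j 0| < 1.
  by move=> gj; rewrite ltNge -in_active_set; apply: contra gj => /gr0 ->.
(* The time at which coordinate [j] reaches the sign of its slope. *)
pose tau j := t + (1 - Num.sg (g j 0) * v j 0) / `|g j 0|.
case: (@arg_minP _ _ _ j0 J tau gj0) => j /= gj jmin.
exists (tau j); split.
  have vj := vlt _ gj; have gj' : 0 < `|g j 0| by rewrite normr_gt0.
  have sv : `|Num.sg (g j 0) * v j 0| < 1.
    by rewrite normrM normr_sg gj mul1r.
  have d0 : 0 < 1 - Num.sg (g j 0) * v j 0.
    by rewrite subr_gt0 (le_lt_trans (ler_norm _)).
  have tj : t < tau j by rewrite ltrDl divr_gt0.
  split => //; exists j; split.
  - rewrite flowE -/g.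
    have -> : v j 0 + (tau j - t) * g j 0 = Num.sg (g j 0).
      rewrite /tau; have [gn|gp|g0'] := ltgtP (g j 0) 0.
      - by rewrite ltr0_sg// ltr0_norm//; field.
      - by rewrite gtr0_sg// gtr0_norm//; field.
      - by rewrite g0' eqxx in gj.
    by rewrite normr_sg gj.
  - by apply: supp; rewrite in_active_set -ltNge.
  - rewrite flowE -/g => /eqP; rewrite addrC -subr_eq0 addrK mulf_eq0.
    by rewrite (negbTE gj) orbF subr_eq0 gt_eqF.
move=> u [tu [k []]]; rewrite !flowE -/g => uk _ nk.
have gk : J k.
  by apply/eqP => gk; apply: nk; rewrite gk mulr0 addr0.
apply: le_trans (jmin _ gk) _; rewrite /= in gk.
have gk' : 0 < `|g k 0| by rewrite normr_gt0.
rewrite /tau -lerBrDl ler_pdivrMr//.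
have sv : `|Num.sg (g k 0) * v k 0| < 1 by rewrite normrM normr_sg gk mul1r vlt.
have ut : 0 < (u - t) * `|g k 0| by rewrite mulr_gt0// subr_gt0.
(* The quantity inside starts above -1 and has increased, so modulus 1 means the value 1. *)
have : `|Num.sg (g k 0) * v k 0 + (u - t) * `|g k 0| | = 1.
  by rewrite -normr_flip_sign.
move: sv; rewrite ltr_norml => /andP[sv1 sv2].
case: (ger0P (Num.sg (g k 0) * v k 0 + (u - t) * `|g k 0|)); lra.
Qed.

(** Active coordinates stand still, and the coordinate that crosses at [s] keeps moving outward, so
    it is still active at later times such as [rho * s]. *)
Lemma active_set_grows s u : is_minimum (crossing_times A t v b r) s -> s <= u ->
  active_set v \proper active_set (flow A t v r u).
Proof.
move=> [[ts [j [vj _ nj]]] _] su.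
move: grad; set g := A^T *m r => gr0.
apply/properP; split.
  apply/fintype.subsetP => i iv.
  rewrite in_active_set flowE -/g gr0// mulr0 addr0.
  by rewrite -in_active_set.
have gj : g j 0 != 0.
  by apply/eqP => gj; apply: nj; rewrite flowE -/g gj mulr0 addr0.
have jv : j \notin active_set v by apply: contra gj => /gr0 ->.
exists j => //; rewrite in_active_set flowE -/g.
move: jv; rewrite in_active_set -ltNge => jv.
have gj' : 0 < `|g j 0| by rewrite normr_gt0.
move: vj; rewrite flowE -/g !(normr_flip_sign _ _ gj).
have sv : `|Num.sg (g j 0) * v j 0| < 1 by rewrite normrM normr_sg gj mul1r.
have st : 0 < (s - t) * `|g j 0| by rewrite mulr_gt0// subr_gt0.
have us : (s - t) * `|g j 0| <= (u - t) * `|g j 0|.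
  by rewrite ler_wpM2r// lerD2r.
move: sv; rewrite ltr_norml => /andP[sv1 sv2].
case: (ger0P (Num.sg (g j 0) * v j 0 + (s - t) * `|g j 0|));
case: (ger0P (Num.sg (g j 0) * v j 0 + (u - t) * `|g j 0|)); lra.
Qed.

End Crossing.

(** The run iterates one step on pairs of a time and a path value, the least squares solution being
    chosen as a function of the path value. *)
Lemma giss_output_exists A (rho lam : R) e : A \in unitmx -> 1 <= rho ->
  0 <= lam -> exists beta, giss_output rho A lam e beta.
Proof.
move=> uA rho1 lam0.
have uAT : A^T \in unitmx by rewrite unitmx_tr.
have /choice[bs bsP] : forall v, exists b,
    restricted_lsq A e (active_set v) b /\
    forall i, i \in active_set v -> (A^T *m (e - A *m b)) i 0 = 0.
  by move=> v; exact: restricted_lsq_exists.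
have bs_supp v i : i \notin active_set v -> bs v i 0 = 0.
  have [[<- _] _] := bsP v.
  by move=> iv; rewrite coord_projE (negbTE iv) mul0r.
have bs_grad v i : i \in active_set v -> (A^T *m (e - A *m bs v)) i 0 = 0.
  by have [_] := bsP v; apply.
pose res v := e - A *m bs v.
(* The default 0 is returned only if there is no minimum; [sminP] excludes this while the residual
   exceeds [lam]. *)
pose smin (t : R) v := xget (0 : R)
  [set s | is_minimum (crossing_times A t v (bs v) (res v)) s].
have sminP t v : lam < `|res v| ->
    is_minimum (crossing_times A t v (bs v) (res v)) (smin t v).
  move=> lr; have [|s sP] := @crossing_min_exists A t v (bs v) (res v)
      (bs_grad v) (bs_supp v).
    apply/eqP => /(congr1 (mulmx (invmx A^T))); rewrite mulmx0 mulKmx// => r0.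
    by move: lr; rewrite r0 normr0 ltNge lam0.
  rewrite /smin; case: xgetP => [x -> //|/(_ s) //].
pose next (tv : R * 'cV[R]_p) :=
  (rho * smin tv.1 tv.2, flow A tv.1 tv.2 (res tv.2) (rho * smin tv.1 tv.2)).
pose t1 : R := 1 / `|A^T *m e|.
(* Times and path values are indexed from 1, hence the shift: [st 0] and [st 1] coincide. *)
pose st k := iter k.-1 next (t1, t1 *: (A^T *m e)).
pose b k := if k is 0 then 0 else bs (st k).2.
pose r k := e - A *m b k.
have r0 : r 0%N = e by rewrite /r /b mulmx0 subr0.
(* Positivity of the time is carried along so that [rho >= 1] yields [s <= rho * s]. At [k = p] the
   lower bound on the cardinal is absurd. *)
have inv k : (forall j, (j <= k)%N -> lam < `|r j|) ->
    0 < (st k.+1).1 /\ (k < #|active_set (st k.+1).2|)%N.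
  elim: k => [|k IH] lr.
    have := lr 0%N (leqnn _); rewrite r0 => le.
    have g0 : 0 < `|A^T *m e|.
      rewrite normr_gt0; apply/eqP => /(congr1 (mulmx (invmx A^T))).
      rewrite mulmx0 mulKmx// => e0.
      by move: le; rewrite e0 normr0 ltNge lam0.
    have t10 : 0 < t1 by rewrite divr_gt0.
    (* The scaling by [t1] gives the first path value maximum norm exactly 1, so some coordinate is
       active. *)
    split => //=; rewrite card_gt0; apply/set0Pn; apply: contrapT => noi.
    have : `|t1 *: (A^T *m e)| = 1.
      by rewrite normrZ gtr0_norm// /t1 mul1r mulVf// gt_eqF.
    apply/eqP; rewrite lt_eqF// [X in X < 1]/Num.Def.normr/= mx_normrE.
    apply: bigmax_lt => // -[i j] _ /=; rewrite ltNge; apply/negP.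
    by rewrite (ord1 j) -in_active_set => ij; apply: noi; exists i.
  have [|t0 ck] := IH; first by move=> j jk; apply: lr; exact: leqW.
  have lrk := lr k.+1 (leqnn _); rewrite /r /b in lrk.
  have mn := sminP (st k.+1).1 _ lrk.
  have ts : (st k.+1).1 < smin (st k.+1).1 (st k.+1).2 by case: mn => -[].
  have su : smin (st k.+1).1 (st k.+1).2
      <= rho * smin (st k.+1).1 (st k.+1).2.
    by rewrite ler_peMl// ltW// (lt_trans t0).
  split; first exact: lt_le_trans (lt_trans t0 ts) su.
  apply: leq_ltn_trans ck _; apply: proper_card.
  exact: (active_set_grows (bs_grad _) mn su).
have exN : exists N, `|r N| <= lam.
  apply: contrapT => noN.
  have lr j : lam < `|r j|.
    by rewrite ltNge; apply/negP => rj; apply: noN; exists j.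
  have [_] := inv p (fun j _ => lr j).
  by rewrite ltnNge (leq_trans (max_card _)) ?card_ord.
case: (@ex_minnP (fun N => `|r N| <= lam) exN) => N rN Nmin.
have lr j : (j < N)%N -> lam < `|r j|.
  by move=> jN; rewrite ltNge; apply/negP => /Nmin; rewrite leqNgt jN.
exists (b N), N, (fun k => (st k).1), (fun k => (st k).2), b, r; split => //.
split => //.
- by rewrite r0.
- by rewrite r0.
- by move=> [//|k] /andP[_ kN]; exact: lr.
- by move=> [//|k] _; have [] := bsP (st k.+1).2.
- move=> [//|k] /andP[_ kN].
  exists (smin (st k.+1).1 (st k.+1).2) => //.
  by apply: sminP; exact: (lr k.+1).
- by move=> [//|k] _.
Qed.

Lemma giss_output_residual A (rho lam : R) e beta :
  giss_output rho A lam e beta -> `|A *m beta - e| <= lam.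
Proof.
move=> [N [t [v [b [r [run ->]]]]]]; have := run_stop run.
have -> : r N = e - A *m b N; last by rewrite distrC.
case: N run => [|N] run; first by rewrite (run_r0 run) (run_b0 run) mulmx0 subr0.
by apply: (run_r run); rewrite leqnn.
Qed.

End GissRun.

(** * Error of the symmetrized estimator *)

Section GissError.
Variables (R : realType) (p : nat).

(** Whichever entry of [W] the rule selects, at (i, j) or (j, i), [O] has the same value at both
    places. *)
Lemma symmetrize_error (W O : 'M[R]_p) (c : R) :
  O^T = O -> `|W - O| <= c -> `|symmetrize W - O| <= c.
Proof.
move=> OT WO; have c0 : 0 <= c by exact: le_trans WO.
have OC i j : O i j = O j i by rewrite -{1}OT mxE.
have h i j : `|W i j - O i j| <= c.
  by apply: le_trans WO; have := ler_mx_norm (W - O) i j; rewrite !mxE.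
apply/mx_norm_leP => // i j; rewrite !mxE.
by case: ifP => _; case: ifP => _ //; rewrite OC.
Qed.

Lemma giss_estimator_error (S S0 : 'M[R]_p) (M eps rho : R) :
  S0 \in unitmx -> (invmx S0)^T = invmx S0 -> norm_L1 (invmx S0) <= M ->
  `|S - S0| <= eps -> p%:R * (M * eps) < 1 -> 1 <= rho ->
  (exists Om, giss_estimator rho S (M * eps) Om) /\
  forall Om, giss_estimator rho S (M * eps) Om ->
    `|Om - invmx S0| <= 2 * M * (M * eps) / (1 - p%:R * (M * eps)).
Proof.
move=> uS0 OT OM Se pl rho1.
have uS : S \in unitmx by exact: (perturbed_unitmx uS0 OM Se erefl pl).
have M0 : 0 <= M by apply: le_trans OM; rewrite /norm_L1; exact: bigmax_ge_id.
have lam0 : 0 <= M * eps by rewrite mulr_ge0// (le_trans _ Se).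
split.
  have /choice[f fP] : forall i : 'I_p, exists beta,
      giss_output rho S (M * eps) (delta_mx i 0) beta.
    by move=> i; exact: giss_output_exists.
  exists (symmetrize (\matrix_(i, j) f j i 0)), (\matrix_(i, j) f j i 0).
  split => // i; rewrite (_ : col i _ = f i)//.
  by apply/colP => k; rewrite !mxE.
move=> _ [W [WP ->]]; apply: symmetrize_error => //.
apply: (approx_inverse_error uS0 OT OM Se erefl pl).
apply/mx_norm_leP => // i j.
(* Up to sign, column [j] of [S W - 1] is the terminal residual for the [j]-th unit vector. *)
have := le_trans (ler_mx_norm _ i 0) (giss_output_residual (WP j)).
rewrite -col_mulmx !mxE; congr (`| _ - _ | <= _).
by rewrite eqxx andbT.
Qed.

End GissError.
(** * Chernoff bounds for i.i.d. samples *)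

Section Independence.
Context {d : measure_display} {T : measurableType d} {R : realType}.
Variable P : probability T R.
Context {d' : measure_display} {T' : measurableType d'}.

Import HBNNSimple.

Local Open Scope ereal_scope.

(** The identity extends by linearity from indicators to simple functions, then by monotone
    convergence. In its application [H] is the product of the other factors and [c] the product of
    their means. *)
Lemma integral_factor_indic_to_fun (H : T -> R) (X : {RV P >-> T'}) (c : R)
    (g : T' -> R) :
  measurable_fun setT H -> (forall w, 0 <= H w)%R ->
  (forall B, measurable B ->
    \int[P]_w (H w * \1_B (X w))%:E = c%:E * P (X @^-1` B)) ->
  measurable_fun setT g -> (forall y, 0 <= g y)%R ->
  \int[P]_w (H w * g (X w))%:E = c%:E * \int[P]_w (g (X w))%:E.
Proof.
move=> mH H0 HB mg g0.
have mg' : measurable_fun setT (EFin \o g) by exact/measurable_EFinP.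
pose s := nnsfun_approx measurableT mg'.
have s_nd y : {homo s^~ y : n m / (n <= m)%N >-> (n <= m)%R}.
  by move=> n m nm; exact/lefP/nd_nnsfun_approx.
have s_cvg y : (fun n => (s n y)%:E) @ \oo --> (g y)%:E.
  by apply: (@cvg_nnsfun_approx _ _ _ _ measurableT _ mg') => // x _; rewrite lee_fin.
have mX : measurable_fun setT X by [].
have mC (h : T' -> R) : measurable_fun setT h -> measurable_fun setT (h \o X).
  by move=> mh; exact: measurableT_comp.
have simple n : \int[P]_w (H w * s n (X w))%:E = c%:E * \int[P]_w (s n (X w))%:E.
  pose B y := s n @^-1` [set y].
  have mB y : measurable (B y) by exact: measurable_funPTI.
  have fin : finite_set (range (s n)) by [].
  have mI y : measurable_fun setT (fun w => \1_(B y) (X w) : R).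
    by apply: mC; exact: measurable_indic.
  have yB0 y w : (0 <= y * \1_(B y) (X w))%R.
    by rewrite -lee_fin EFinM; exact: nnfun_muleindic_ge0.
  transitivity (\int[P]_w \sum_(y \in range (s n)) (H w * (y * \1_(B y) (X w)))%:E).
    apply: eq_integral => w _; rewrite (fimfunE (s n) (X w)).
    by rewrite !fsbig_finite// sumEFin mulr_sumr.
  rewrite ge0_integral_fsum//; last 2 first.
  - move=> y; apply/measurable_EFinP; apply: measurable_funM => //.
    exact: measurable_funM.
  - by move=> y w _; rewrite lee_fin mulr_ge0.
  transitivity (c%:E * \int[P]_w \sum_(y \in range (s n)) (y * \1_(B y) (X w))%:E).
    rewrite ge0_integral_fsum//; last 2 first.
    - by move=> y; apply/measurable_EFinP; exact: measurable_funM.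
    - by move=> y w _; rewrite lee_fin.
    rewrite !fsbig_finite// ge0_sume_distrr; last first.
      by move=> y _; apply: integral_ge0 => w _; rewrite lee_fin.
    rewrite big_seq [RHS]big_seq; apply: eq_bigr => y.
    rewrite in_fset_set// inE => -[x _ <-].
    set y' := s n x.
    have y0 : (0 <= y')%R by [].
    under eq_integral do rewrite mulrCA EFinM.
    rewrite ge0_integralZl//; last 2 first.
    - by apply/measurable_EFinP; exact: measurable_funM.
    - by move=> w _; rewrite lee_fin mulr_ge0.
    under [in RHS]eq_integral do rewrite EFinM.
    rewrite ge0_integralZl//; last by apply/measurable_EFinP.
    rewrite HB// muleCA; congr (_ * (_ * _)).
    rewrite -[X @^-1` _]setIT -integral_indic//.
    by rewrite -[_ @^-1` _]setTI; exact: mX.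
  congr (_ * _); apply: eq_integral => w _; rewrite (fimfunE (s n) (X w)).
  by rewrite !fsbig_finite// sumEFin.
have lim1 : (fun n => \int[P]_w (H w * s n (X w))%:E) @ \oo -->
    \int[P]_w (H w * g (X w))%:E.
  have := @cvg_monotone_convergence _ _ _ P setT measurableT
    (fun n w => (H w * s n (X w))%:E).
  rewrite (_ : (fun x => limn _) = (fun w => (H w * g (X w))%:E)); last first.
    apply/funext => w; apply/cvg_lim => //.
    under eq_fun do rewrite EFinM.
    by rewrite EFinM; apply: cvgeZl.
  apply.
  - move=> n; apply/measurable_EFinP; apply: measurable_funM => //.
    by apply: mC; exact/measurable_funP.
  - by move=> n w _; rewrite lee_fin mulr_ge0.
  - by move=> w _ n m nm; rewrite lee_fin ler_wpM2l// s_nd.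
have lim2 : (fun n => \int[P]_w (s n (X w))%:E) @ \oo -->
    \int[P]_w (g (X w))%:E.
  have := @cvg_monotone_convergence _ _ _ P setT measurableT
    (fun n w => (s n (X w))%:E).
  rewrite (_ : (fun x => limn _) = (fun w => (g (X w))%:E)); last first.
    by apply/funext => w; apply/cvg_lim.
  apply.
  - by move=> n; apply/measurable_EFinP; apply: mC; exact/measurable_funP.
  - by move=> n w _; rewrite lee_fin.
  - by move=> w _ n m nm; rewrite lee_fin s_nd.
have lim3 : (fun n => c%:E * \int[P]_w (s n (X w))%:E) @ \oo -->
    c%:E * \int[P]_w (g (X w))%:E by exact: cvgeZl.
move: lim1; under eq_fun do rewrite simple.
by move=> lim1; have := cvg_unique _ lim1 lim3; apply.
Qed.

Lemma integral_prod_independent n (X : 'I_n -> {RV P >-> T'})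
    (h : 'I_n -> T' -> R) (a : 'I_n -> R) :
  independent_rvs X -> (forall k, measurable_fun setT (h k)) ->
  (forall k y, 0 <= h k y)%R ->
  (forall k, \int[P]_w (h k (X k w))%:E = (a k)%:E) ->
  \int[P]_w (\prod_k h k (X k w))%:E = (\prod_k a k)%:E.
Proof.
move=> indX.
(* Induction on the number [m] of leading factors that may be arbitrary, the others being
   indicators. For [m = 0] the claim is independence of events. *)
suff main m : (m <= n)%N -> forall (h : 'I_n -> T' -> R) (a : 'I_n -> R),
    (forall k, measurable_fun setT (h k)) -> (forall k y, 0 <= h k y)%R ->
    (forall k, \int[P]_w (h k (X k w))%:E = (a k)%:E) ->
    (forall k : 'I_n, (m <= k)%N -> exists2 B, measurable B & h k = \1_B) ->
    \int[P]_w (\prod_k h k (X k w))%:E = (\prod_k a k)%:E.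
  move=> mh h0 ha; apply: (main n (leqnn n)) => // k.
  by rewrite leqNgt ltn_ord.
elim: m => [_|m IH mn] {}h {}a mh h0 ha hB.
  have /choice[B BP] : forall k, exists B, measurable B /\ h k = \1_B.
    by move=> k; have [B mB ->] := hB k (leq0n _); exists B.
  have mXB k : measurable (X k @^-1` B k).
    by apply: measurable_funPTI; have [] := BP k.
  have aP k : (a k)%:E = P (X k @^-1` B k).
    rewrite -ha; have [_ ->] := BP k.
    by rewrite -[X in P X]setIT -integral_indic.
  have PI := indX [set: 'I_n]%SET B (fun k => (BP k).1).
  rewrite -prodEFin.
  transitivity (P (\bigcap_(k in [set` [set: 'I_n]%SET]) (X k @^-1` B k))).
    rewrite -[X in P X]setIT -integral_indic//; last first.
      exact: fin_bigcap_measurable.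
    apply: eq_integral => w _; congr EFin.
    rewrite indicE; have [wB|wB] := boolP (w \in _).
      rewrite big1// => k _; have [_ ->] := BP k; rewrite indicE.
      by rewrite mem_set//; rewrite inE in wB; apply: wB; rewrite /= inE.
    have [k wk] : exists k, ~ B k (X k w).
      apply/not_existsP => wk; move/negP: wB; apply; rewrite inE => k _.
      by apply: contrapT; exact: wk.
    rewrite (bigD1 k)//=; have [_ ->] := BP k; rewrite indicE memNset ?mul0r//.
  rewrite PI; apply: eq_big => [k|k _]; first by rewrite inE.
  by rewrite aP.
pose k0 := Ordinal mn.
pose H w := (\prod_(k | k != k0) h k (X k w))%R.
have mhX k : measurable_fun setT (fun w => h k (X k w)).
  exact: (measurableT_comp (mh k)).
rewrite (bigD1 k0)//= mulrC EFinM -ha.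
transitivity (\int[P]_w (H w * h k0 (X k0 w))%:E).
  by apply: eq_integral => w _; rewrite (bigD1 k0)//= mulrC.
apply: integral_factor_indic_to_fun => //.
- rewrite /H; under eq_fun do rewrite -big_filter.
  by apply: measurable_prod => k _.
- by move=> w; apply: prodr_ge0.
move=> B mB.
have mXB : measurable (X k0 @^-1` B) by exact: measurable_funPTI.
have PB : (fine (P (X k0 @^-1` B)))%:E = P (X k0 @^-1` B).
  by rewrite fineK// fin_num_measure.
rewrite -PB -EFinM.
(* With factor [k0] replaced by an indicator, the product falls under the induction hypothesis. *)
pose h' k := if k == k0 then \1_B else h k.
pose a' k := if k == k0 then fine (P (X k0 @^-1` B)) else a k.
have /= := IH (ltnW mn) h' a' _ _ _ _.
rewrite (bigD1 k0)//= /a' eqxx mulrC.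
under eq_bigr => k kk0 do rewrite (negbTE kk0).
move=> <-.
- apply: eq_integral => w _; rewrite (bigD1 k0)//= /h' eqxx mulrC.
  by congr (_ * _)%:E; apply: eq_bigr => k /negbTE ->.
- by move=> k; rewrite /h'; case: ifP => _ //; exact: measurable_indic.
- by move=> k y; rewrite /h'; case: ifP => _ //; rewrite indicE.
- move=> k; rewrite /h'; case: ifP => [/eqP ->|_] //.
  by rewrite PB -[X in P X]setIT -integral_indic.
- move=> k mk; rewrite /h'; case: ifP => [_|kk0]; first by exists B.
  apply: hB; rewrite ltn_neqAle mk andbT; apply: contraFN kk0 => /eqP mk'.
  exact/eqP/val_inj.
Qed.

Lemma ge0_integral_iid n (X : {RV P >-> T'}) (Xs : 'I_n -> {RV P >-> T'})
    (f : T' -> R) k :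
  iid_samples X Xs -> measurable_fun setT f -> (forall y, 0 <= f y)%R ->
  \int[P]_w (f (Xs k w))%:E = \int[P]_w (f (X w))%:E.
Proof.
move=> [_ id] mf f0.
have mf' : measurable_fun setT (EFin \o f) by exact/measurable_EFinP.
have f0' y : 0 <= (EFin \o f) y by rewrite lee_fin.
rewrite -[LHS](ge0_integral_distribution (Xs k) mf' f0').
rewrite -[RHS](ge0_integral_distribution X mf' f0').
by apply: eq_measure_integral => A mA _; exact: id.
Qed.

(** Markov's inequality, in product form so that [c = 0] is allowed. *)
Lemma le_measure_integral (A : set T) (Y : T -> R) (c : R) : measurable A ->
  measurable_fun setT Y -> (forall w, 0 <= Y w)%R -> (0 <= c)%R ->
  (forall w, A w -> (c <= Y w)%R) ->
  c%:E * P A <= \int[P]_w (Y w)%:E.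
Proof.
move=> mA mY Y0 c0 cY.
rewrite -[X in P X]setIT -integral_indic// -ge0_integralZl_EFin//.
- apply: ge0_le_integral => //.
  + by move=> w _; rewrite -EFinM lee_fin mulr_ge0.
  + by apply/measurable_EFinP; exact: measurable_funM.
  + exact/measurable_EFinP.
  + move=> w _; rewrite lee_fin indicE.
    by have [|_] := boolP (w \in A); rewrite ?mulr0// inE mulr1; exact: cY.
- exact/measurable_EFinP.
Qed.

(** Markov's inequality for the exponential of the sum, whose mean is an [n]-th power by
    independence and equality of laws. *)
Lemma chernoff_iid n (X : {RV P >-> T'}) (Xs : 'I_n -> {RV P >-> T'})
    (f : T' -> R) (a m : R) :
  iid_samples X Xs -> measurable_fun setT f ->
  \int[P]_w (expR (f (X w)))%:E <= m%:E ->
  P [set w | a <= \sum_k f (Xs k w)]%R <= (expR (- a) * m ^+ n)%:E.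
Proof.
move=> iid mf Em.
have mef : measurable_fun setT (fun y => expR (f y)).
  exact: (measurableT_comp (@measurable_expR R)).
have mfX k : measurable_fun setT (fun w => f (Xs k w)).
  exact: (measurableT_comp mf).
have ms : measurable_fun setT (fun w => \sum_k f (Xs k w))%R.
  exact: measurable_sum.
have E0 : 0 <= \int[P]_w (expR (f (X w)))%:E.
  by apply: integral_ge0 => w _; rewrite lee_fin expR_ge0.
have Efin : (fine (\int[P]_w (expR (f (X w)))%:E))%:E
    = \int[P]_w (expR (f (X w)))%:E.
  by rewrite fineK// ge0_fin_numE// (le_lt_trans Em)// ltry.
have ef : \int[P]_w (expR (\sum_k f (Xs k w)))%:E
    = (fine (\int[P]_w (expR (f (X w)))%:E) ^+ n)%:E.
  under eq_integral do rewrite (big_morph expR (@expRD R) (@expR0 R)).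
  rewrite (integral_prod_independent (h := fun=> fun y => expR (f y))
    (a := fun=> fine (\int[P]_w (expR (f (X w)))%:E))).
  - by rewrite prodr_const card_ord.
  - by case: iid.
  - by [].
  - by move=> k y; exact: expR_ge0.
  - move=> k; rewrite Efin.
    by apply: (@ge0_integral_iid _ _ _ (fun y => expR (f y))) => // y; exact: expR_ge0.
have mA : measurable [set w | a <= \sum_k f (Xs k w)]%R.
  rewrite -[X in measurable X]setTI.
  exact: measurable_fun_le.
rewrite expRN mulrC EFinM lee_pdivlMr ?expR_gt0// muleC.
apply: (@le_trans _ _ (\int[P]_w (expR (\sum_k f (Xs k w)))%:E)).
  apply: le_measure_integral => //.
  - exact: (measurableT_comp (@measurable_expR R)).
  - by move=> w /=; rewrite ler_expR.
rewrite ef lee_fin lerXn2r// ?nnegrE ?fine_ge0//.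
  by rewrite -lee_fin (le_trans E0).
by rewrite -lee_fin Efin.
Qed.

(** [G] dominates the remainder of the first-order expansion; integrating gives at most
    [1 + mu + g], and [1 + x <= exp x] concludes. *)
Lemma integral_expR_le (X : {RV P >-> T'}) (f G : T' -> R) (mu g : R) :
  measurable_fun setT f -> measurable_fun setT G -> (forall y, 0 <= G y)%R ->
  P.-integrable setT (fun w => (f (X w))%:E) ->
  \int[P]_w (f (X w))%:E = mu%:E -> \int[P]_w (G (X w))%:E <= g%:E ->
  (forall y, expR (f y) <= 1 + f y + G y)%R ->
  \int[P]_w (expR (f (X w)))%:E <= (expR (mu + g))%:E.
Proof.
move=> mf mG G0 intf fmu Gg fG.
have mX : measurable_fun setT X by [].
have mfX : measurable_fun setT (fun w => f (X w)) by exact: (measurableT_comp mf).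
have mGX : measurable_fun setT (fun w => G (X w)) by exact: (measurableT_comp mG).
have int1 : P.-integrable setT (fun=> 1%:E : \bar R).
  by apply: finite_measure_integrable_cst.
have intG : P.-integrable setT (fun w => (G (X w))%:E).
  apply/integrableP; split; first exact/measurable_EFinP.
  under eq_integral => w _ do rewrite gee0_abs ?lee_fin//.
  by rewrite (le_lt_trans Gg)// ltry.
apply: (@le_trans _ _ (\int[P]_w (1%:E + (f (X w))%:E + (G (X w))%:E))).
  apply: ge0_le_integral => //.
  - by apply/measurable_EFinP; exact: (measurableT_comp (@measurable_expR R)).
  - apply: emeasurable_funD; last exact/measurable_EFinP.
    by apply: emeasurable_funD => //; exact/measurable_EFinP.
  - by move=> w _; rewrite -!EFinD lee_fin.
rewrite integralD//; last exact: integrableD.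
rewrite integralD// fmu integral_cst//= probability_setT mule1.
apply: (@le_trans _ _ (1%:E + mu%:E + g%:E)); first by rewrite leeD2l.
by rewrite -!EFinD lee_fin -addrA expR_ge1Dx.
Qed.

Lemma iid_sum_deviation n (X : {RV P >-> T'}) (Xs : 'I_n -> {RV P >-> T'})
    (f G : T' -> R) (mu u g x : R) :
  iid_samples X Xs -> measurable_fun setT f -> measurable_fun setT G ->
  (forall y, 0 <= G y)%R ->
  P.-integrable setT (fun w => (f (X w))%:E) ->
  \int[P]_w (f (X w))%:E = mu%:E -> \int[P]_w (G (X w))%:E <= g%:E ->
  (forall y, expR (u * f y) <= 1 + u * f y + G y)%R ->
  P [set w | n%:R * (u * mu + x) <= \sum_k u * f (Xs k w)]%R
    <= (expR (n%:R * (g - x)))%:E.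
Proof.
move=> iid mf mG G0 intf fmu Gg fG.
have mX : measurable_fun setT X by [].
have muf : measurable_fun setT (fun y => u * f y)%R by exact: measurable_funM.
have Eu : \int[P]_w (expR (u * f (X w)))%:E <= (expR (u * mu + g))%:E.
  apply: (integral_expR_le (f := fun y => (u * f y)%R) (G := G)) => //.
  - by under eq_fun do rewrite EFinM; exact: integrableZl.
  - by under eq_integral do rewrite EFinM; rewrite integralZl// fmu.
apply: (le_trans (chernoff_iid (f := fun y => (u * f y)%R) _ iid muf Eu)).
rewrite lee_fin -expRM_natl -expRD ler_expR; lra.
Qed.

(** A two-sided deviation is one of two one-sided ones, with exponents [u] and [- u]; hence [G] has
    to bound the remainder for both signs. *)
Lemma iid_average_deviation n (X : {RV P >-> T'}) (Xs : 'I_n -> {RV P >-> T'})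
    (f G : T' -> R) (mu u g x : R) : (0 < n)%N ->
  iid_samples X Xs -> measurable_fun setT f -> measurable_fun setT G ->
  (forall y, 0 <= G y)%R ->
  P.-integrable setT (fun w => (f (X w))%:E) ->
  \int[P]_w (f (X w))%:E = mu%:E -> \int[P]_w (G (X w))%:E <= g%:E ->
  (0 <= u)%R ->
  (forall (v : R) y, `|v| = u -> expR (v * f y) <= 1 + v * f y + G y)%R ->
  let A := [set w | x <= `|n%:R^-1 * (\sum_k f (Xs k w)) - mu|]%R in
  measurable A /\ P A <= (2 * expR (n%:R * (g - u * x)))%:E.
Proof.
move=> n0 iid mf mG G0 intf fmu Gg u0 fG.
have mS : measurable_fun setT (fun w => \sum_k f (Xs k w))%R.
  by apply: measurable_sum => k; exact: (measurableT_comp mf).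
set A := [set w | _]; cbv zeta.
have mA : measurable A.
  rewrite /A -[X in measurable X]setTI; apply: measurable_fun_le => //.
  apply: measurableT_comp => //; apply: measurable_funB => //.
  exact: measurable_funM.
split => //.
pose B v := [set w | n%:R * (v * mu + u * x) <= \sum_k v * f (Xs k w)]%R.
have mB v : measurable (B v).
  rewrite /B -[X in measurable X]setTI; apply: measurable_fun_le => //.
  by under eq_fun do rewrite -mulr_sumr; exact: measurable_funM.
have AB : A `<=` B u `|` B (- u)%R.
  move=> w; rewrite /A /B /= -!mulr_sumr => xw.
  have n0' : (0 < n%:R :> R)%R by rewrite ltr0n.
  set S := (\sum_k f (Xs k w))%R in xw *.
  have SE : S = (n%:R * (n%:R^-1 * S))%R by rewrite mulrA divff ?gt_eqF// mul1r.
  rewrite SE; set a := (n%:R^-1 * S)%R in xw *.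
  rewrite (mulrCA u) (mulrCA (- u)%R) !ler_pM2l//.
  have := ler_wpM2l u0 xw.
  by case: (ger0P (a - mu)) => _ h; [left|right]; lra.
apply: (@le_trans _ _ (P (B u) + P (B (- u)%R))).
  apply: (le_trans _ (measureU2 _ (mB _) (mB _))).
  by apply: le_measure; rewrite ?inE//; exact: measurableU.
have PB (v : R) : `|v|%R = u -> P (B v) <= (expR (n%:R * (g - u * x)))%:E.
  move=> vu; apply: (@iid_sum_deviation n X Xs f G mu v g (u * x)%R) => // y.
  exact: fG.
rewrite mulrDl mul1r EFinD leeD// PB// ?normrN ger0_norm//.
Qed.

End Independence.

(** * Second-order bounds for the exponential *)

Section ExpInequalities.
Variable R : realType.
Implicit Types x y z : R.

Lemma is_derive_expRN z : is_derive z 1 (fun x => expR (- x)) (- expR (- z)).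
Proof.
have := @is_derive1_comp R expR (fun x => - x) z _ _ (is_derive_expR (- z))
  (is_deriveN (is_derive_id z 1)).
by rewrite mulrN1.
Qed.

Lemma expR_ge1Dx2 y : 0 <= y -> 1 + y + y ^+ 2 / 2 <= expR y.
Proof.
move=> y0; pose f z := expR z - (1 + z + z ^+ 2 / 2).
have df z : is_derive z 1 f (expR z - (1 + z)).
  apply: is_derive_eq.
  by rewrite /GRing.scale/=; field.
have : f 0 <= f y.
  apply: (@ger0_derive1_ndecry R f 0) => //.
  - by move=> x _; rewrite derive1E (@derive_val _ _ _ _ _ _ _ (df x))
      subr_ge0 expR_ge1Dx.
  - apply: continuous_subspaceT => x.
    by apply: differentiable_continuous; apply/derivable1_diffP.
rewrite /f expR0; lra.
Qed.

(* The factor 1/2 is what makes the constant D0 of the polynomial case sharp enough. *)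
Lemma expR_le_Taylor2 z : expR z <= 1 + z + z ^+ 2 / 2 * expR `|z|.
Proof.
case: (ger0P z) => [z0|z0].
  (* Multiplied by [exp(- z)], the claim becomes [f 0 <= f z]; the derivative [x (1 - exp(- x))] is
     nonnegative for [x >= 0]. *)
  pose f y := (1 + y) * expR (- y) + y ^+ 2 / 2.
  have dE x := is_derive_expRN x.
  have df x : is_derive x 1 f (x * (1 - expR (- x))).
    by apply: is_derive_eq; rewrite /GRing.scale/=; field.
  have : f 0 <= f z.
    apply: (@ger0_derive1_ndecry R f 0) => //.
    - move=> x; rewrite in_itv/= andbT => x0.
      rewrite derive1E (@derive_val _ _ _ _ _ _ _ (df x)).
      by rewrite mulr_ge0 ?(ltW x0)// subr_ge0 -expR0 ler_expR oppr_le0 ltW.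
    - apply: continuous_subspaceT => x.
      by apply: differentiable_continuous; apply/derivable1_diffP.
  rewrite /f oppr0 expR0 => h.
  have e0 := expR_gt0 z.
  have : (1 + 0) * 1 + 0 ^+ 2 / 2 <= ((1 + z) * expR (- z) + z ^+ 2 / 2) by [].
  move=> /(ler_wpM2l (ltW e0)).
  have : expR z * expR (- z) = 1 by rewrite expRN divff// gt_eqF.
  nra.
set y := - z; have y0 : 0 < y by rewrite oppr_gt0.
have -> : z = - y by rewrite opprK.
have h := expR_ge1Dx2 (ltW y0).
have e0 := expR_gt0 (- y).
have ee : expR y * expR (- y) = 1 by rewrite expRN divff// gt_eqF// expR_gt0.
(* Here [exp y >= 1 + y + y^2/2], and the product of [1 + y + y^2/2] and [1 - y + y^2/2] is
   [1 + y^4/4 >= 1]. *)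
have e1 : expR (- y) <= 1 - y + y ^+ 2 / 2.
  have : (1 + y + y ^+ 2 / 2) * expR (- y) <= 1.
    by rewrite -[leRHS]ee ler_wpM2r// ltW.
  have : 1 <= (1 - y + y ^+ 2 / 2) * (1 + y + y ^+ 2 / 2).
    have -> : (1 - y + y ^+ 2 / 2) * (1 + y + y ^+ 2 / 2) = 1 + (y ^+ 2) ^+ 2 / 4.
      by field.
    by rewrite lerDl divr_ge0// sqr_ge0.
  move=> h1 h2.
  rewrite -(@ler_pM2l _ (1 + y + y ^+ 2 / 2)).
    by rewrite (le_trans h2)// mulrC.
  by rewrite !addr_gt0// divr_gt0// exprn_gt0.
apply: (le_trans e1); rewrite (sqrrN y) lerD2l ler_peMr ?divr_ge0 ?sqr_ge0//.
by rewrite -expR0 ler_expR ltW.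
Qed.

End ExpInequalities.

(** * Sample covariance *)

Section SampleCovariance.
Variables (R : realType) (n p : nat) (x : 'I_n -> 'cV[R]_p) (mu : 'I_p -> R).
Hypothesis n2 : (2 <= n)%N.

Let av (f : 'I_n -> R) : R := n%:R^-1 * \sum_k f k.
Let y k i := x k i 0 - mu i.

Let n0 : n%:R != 0 :> R. Proof. by rewrite pnatr_eq0 -lt0n ltnW. Qed.

(** Deviations from the sample mean do not change when the data are shifted by [mu]; the entry then
    involves only averages to which Chernoff's bound applies. *)
Lemma sample_covE i j : sample_cov x i j =
  n.-1%:R^-1 * (n%:R * (av (fun k => y k i * y k j) -
                        av (y^~ i) * av (y^~ j))).
Proof.
rewrite /sample_cov mxE summxE; congr (_ * _).
have mE l : sample_mean x l 0 = av (y^~ l) + mu l.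
  rewrite /sample_mean mxE summxE /av /y sumrB sumr_const card_ord mulrBr.
  by rewrite -[mu l *+ n]mulr_natl mulKf// subrK.
have xm k l : (x k - sample_mean x) l 0 = y k l - av (y^~ l).
  by rewrite mxE [X in _ + X]mxE mE /y; ring.
transitivity (\sum_k (y k i * y k j - y k i * av (y^~ j)
                      - av (y^~ i) * y k j + av (y^~ i) * av (y^~ j))).
  by apply: eq_bigr => k _; rewrite mxE big_ord1 [X in _ * X]mxE !xm; ring.
rewrite big_split/= !sumrB -mulr_suml -mulr_sumr sumr_const card_ord.
have sE l : \sum_k y k l = n%:R * av (y^~ l) by rewrite /av mulVKf.
rewrite !sE -[X in X - _ - _]/(\sum_k y k i * y k j).
have -> : \sum_k y k i * y k j = n%:R * av (fun k => y k i * y k j).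
  by rewrite /av mulVKf.
by rewrite -[_ *+ n]mulr_natl; ring.
Qed.

(** As [n/(n-1) = 1 + 1/(n-1)], the error is the inflated deviation of the averages plus
    [Sigma/(n-1)]. *)
Lemma sample_cov_error (Sigma : 'M[R]_p) (al be si : R) :
  (forall i j, `|av (fun k => y k i * y k j) - Sigma i j| <= al) ->
  (forall i, `|av (y^~ i)| <= be) -> (forall i j, `|Sigma i j| <= si) ->
  0 <= al -> 0 <= be -> 0 <= si ->
  `|sample_cov x - Sigma|
    <= (1 + n.-1%:R^-1) * (al + be ^+ 2) + n.-1%:R^-1 * si.
Proof.
move=> Hal Hbe Hsi al0 be0 si0.
have m0 : 0 < n.-1%:R :> R by rewrite ltr0n -ltnS prednK// ltnW.
have nE : n%:R = n.-1%:R + 1 :> R by rewrite natr1 prednK// ltnW.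
apply/mx_norm_leP => [|i j].
  by rewrite addr_ge0 ?mulr_ge0 ?addr_ge0 ?invr_ge0 ?sqr_ge0.
rewrite mxE [X in _ + X]mxE sample_covE.
set a := av _; set b := av _; set c := av _.
have -> : n.-1%:R^-1 * (n%:R * (a - b * c)) - Sigma i j =
    (1 + n.-1%:R^-1) * ((a - Sigma i j) - b * c) + n.-1%:R^-1 * Sigma i j.
  by rewrite nE; field; rewrite gt_eqF.
apply: (le_trans (ler_normD _ _)); rewrite !normrM.
rewrite (@ger0_norm _ (1 + _)) ?addr_ge0 ?invr_ge0// (@ger0_norm _ (_^-1))
  ?invr_ge0//.
apply: lerD; rewrite ler_wpM2l ?addr_ge0 ?invr_ge0//.
apply: (le_trans (ler_normB _ _)); apply: lerD; first exact: Hal.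
by rewrite normrM expr2 ler_pM//; exact: Hbe.
Qed.

End SampleCovariance.

(** * Union bound for events not known to be measurable *)

Section UnionBound.
Context {d : measure_display} {T : measurableType d} {R : realType}.
Variable P : probability T R.

(** The complement of the union of the [A i] is the measurable subset of [G] that [prob_at_least]
    asks for. *)
Lemma prob_at_least_union (I : finType) (A : I -> set T) (b : I -> R) (c : R)
    (G : set T) :
  (forall i, measurable (A i)) -> (forall i, (P (A i) <= (b i)%:E)%E) ->
  c <= 1 - \sum_i b i -> (forall w, (forall i, ~ A i w) -> G w) ->
  prob_at_least P c G.
Proof.
move=> mA Ab cb AG; pose U s := \big[setU/set0]_(i <- s) A i.
have mU s : measurable (U s) by exact: bigsetU_measurable.
have PU s : (P (U s) <= (\sum_(i <- s) b i)%:E)%E.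
  elim: s => [|i s IH]; first by rewrite /U !big_nil measure0.
  rewrite /U !big_cons EFinD; apply: le_trans (measureU2 _ (mA i) (mU s)) _.
  by apply: leeD; [exact: Ab|exact: IH].
exists (~` U (index_enum I)); split; first exact: measurableC.
  move=> w wU; apply: AG => i Aiw; apply: wU.
  by rewrite /U -bigcup_seq; exists i => //=; exact: mem_index_enum.
rewrite probability_setC//.
apply: (@le_trans _ _ (1 - (\sum_i b i)%:E)%E); first by rewrite -EFinB lee_fin.
by rewrite leeD2l// leeN2; exact: PU.
Qed.

Lemma prob_at_least_le0 (c : R) (G : set T) : c <= 0 -> prob_at_least P c G.
Proof.
by move=> c0; exists set0; split => //; rewrite measure0 lee_fin.
Qed.

End UnionBound.

(** * Upper bounds on means of nonnegative functions *)

Section MeanBounds.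
Context {d : measure_display} {T : measurableType d} {R : realType}.
Variable P : probability T R.
Implicit Types F G : T -> R.

(** Stated on the extended integral, the bound presupposes no integrability; integrability is
    deduced from it by domination. *)
Definition mean_le F (c : R) : Prop :=
  [/\ measurable_fun setT F, forall w, 0 <= F w
    & (\int[P]_w (F w)%:E <= c%:E)%E].

Lemma mean_le_trans F G (c c' : R) : measurable_fun setT F ->
  (forall w, 0 <= F w <= G w) -> c <= c' -> mean_le G c -> mean_le F c'.
Proof.
move=> mF FG cc [mG G0 Gc]; split => // [w|]; first by have /andP[] := FG w.
apply: (@le_trans _ _ (\int[P]_w (G w)%:E)%E).
  apply: ge0_le_integral => //.
  - by move=> w _; rewrite lee_fin; have /andP[] := FG w.
  - exact/measurable_EFinP.
  - exact/measurable_EFinP.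
  - by move=> w _; rewrite lee_fin; have /andP[] := FG w.
by apply: (le_trans Gc); rewrite lee_fin.
Qed.

Lemma mean_leD F G (a b : R) :
  mean_le F a -> mean_le G b -> mean_le (fun w => F w + G w) (a + b).
Proof.
move=> [mF F0 Fa] [mG G0 Gb]; split; first exact: measurable_funD.
  by move=> w; rewrite addr_ge0.
under eq_integral do rewrite EFinD.
rewrite ge0_integralD//; first by rewrite EFinD leeD.
all: try by move=> w _; rewrite lee_fin.
all: exact/measurable_EFinP.
Qed.

Lemma mean_leZ F (k a : R) : 0 <= k ->
  mean_le F a -> mean_le (fun w => k * F w) (k * a).
Proof.
move=> k0 [mF F0 Fa]; split; first exact: measurable_funM.
  by move=> w; rewrite mulr_ge0.
under eq_integral do rewrite EFinM.
rewrite ge0_integralZl_EFin//; first by rewrite EFinM lee_wpmul2l ?lee_fin.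
  by move=> w _; rewrite lee_fin.
exact/measurable_EFinP.
Qed.

Lemma mean_le_cst (c : R) : 0 <= c -> mean_le (fun=> c) c.
Proof.
by move=> c0; split => //; rewrite integral_cst//= probability_setT mule1.
Qed.

Lemma mean_le_ge0 F c : mean_le F c -> 0 <= c.
Proof.
move=> [mF F0 Fc]; rewrite -lee_fin; apply: le_trans Fc.
by apply: integral_ge0 => w _; rewrite lee_fin.
Qed.

Lemma mean_le_integrable F G c : measurable_fun setT F ->
  (forall w, `|F w| <= G w) -> mean_le G c ->
  P.-integrable setT (fun w => (F w)%:E).
Proof.
move=> mF FG [mG G0 Gc]; apply/integrableP; split; first exact/measurable_EFinP.
have [_ _] : mean_le (fun w => `|F w|) c.
  apply: (@mean_le_trans _ G c c) => //; first exact: measurableT_comp.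
  by move=> w; rewrite normr_ge0 FG.
by move=> Fc; apply: (le_lt_trans Fc); rewrite ltry.
Qed.

Lemma norm_integral_le F G (m c : R) : measurable_fun setT F ->
  (forall w, `|F w| <= G w) -> mean_le G c ->
  (\int[P]_w (F w)%:E = m%:E)%E -> `|m| <= c.
Proof.
move=> mF FG Gc Fm.
have [_ _ Fc] : mean_le (fun w => `|F w|) c.
  apply: (@mean_le_trans _ G c c) => //; first exact: measurableT_comp.
  by move=> w; rewrite normr_ge0 FG.
rewrite -lee_fin; apply: le_trans Fc.
have := @le_abse_integral _ _ _ P setT (EFin \o F) measurableT.
rewrite Fm => /(_ _)/le_trans; apply; first exact/measurable_EFinP.
exact: lexx.
Qed.

End MeanBounds.

(** * Moments of the centered coordinates *)

Section CenteredCoordinates.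
Context {d : measure_display} {T : measurableType d} {R : realType}.
Variable P : probability T R.
Variables (p : nat) (X : {RV P >-> p.-tuple R}) (mu : 'I_p -> R).
Variable Sigma : 'M[R]_p.
Hypothesis XmS : has_mean_cov P X mu Sigma.

Definition centered (i : 'I_p) (y : p.-tuple R) : R := tnth y i - mu i.

Lemma measurable_centered i : measurable_fun setT (centered i).
Proof. by apply: measurable_funB => //; exact: measurable_tnth. Qed.

Lemma measurable_centered_rv i : measurable_fun setT (fun w => centered i (X w)).
Proof. exact: (measurableT_comp (measurable_centered i)). Qed.

Let fin_P : P setT \is a fin_num.
Proof. by rewrite probability_setT. Qed.

Let coord_Lfun2 i : (fun w => centered i (X w)) \in Lfun P 2%:E.
Proof.
have [L2 _ _] := XmS.
rewrite (_ : (fun w => _) = rv_coord X i \- cst (mu i))//.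
by apply: rpredB => [|one2|one2]; [rewrite lee_fin ler1n|exact: L2|exact: Lfun_cst].
Qed.

Lemma centered_integrable i :
  P.-integrable setT (fun w => (centered i (X w))%:E).
Proof.
apply/Lfun1_integrable; apply: Lfun_subset12 => //; exact: coord_Lfun2.
Qed.

Lemma centered_mean i : (\int[P]_w (centered i (X w))%:E = 0)%E.
Proof.
have [L2 EX _] := XmS.
have := @expectationB _ _ _ P (rv_coord X i) (cst (mu i)).
rewrite EX expectation_cst -EFinB subrr unlock => -> //.
- exact: Lfun_subset12.
- by apply: Lfun_cst.
Qed.

Lemma centered_mul_integrable i j :
  P.-integrable setT (fun w => (centered i (X w) * centered j (X w))%:E).
Proof. by apply/Lfun1_integrable; exact: Lfun2_mul_Lfun1. Qed.

Lemma centered_mul_mean i j :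
  (\int[P]_w (centered i (X w) * centered j (X w))%:E = (Sigma i j)%:E)%E.
Proof.
by have [_ EX <-] := XmS; rewrite unlock !EX/= unlock.
Qed.

End CenteredCoordinates.

(** * From covariance error to estimator error *)

Section Reduction.
Context {d : measure_display} {T : measurableType d} {R : realType}.
Variable P : probability T R.

Lemma giss_within_cov_near n p (X : {RV P >-> p.-tuple R})
    (Xs : 'I_n -> {RV P >-> p.-tuple R}) mu Sigma0 q s0 M rho (C s : R) :
  giss_setting X Xs mu Sigma0 q s0 M rho ->
  let lambda := C * M * s in
  (exists2 varrho : R, 0 < varrho & lambda < 1 / p%:R - varrho) ->
  forall w, `|sample_cov_rv Xs w - Sigma0| <= C * s ->
  giss_within Xs rho lambda
    (C * (3%:R + (1 + 3%:R * p%:R * lambda) / (1 - p%:R * lambda))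
       * M ^+ 2 * s) (invmx Sigma0) w.
Proof.
move=> [_ p1 _ _ uS _ [[OT _] OM _] rho1] lambda [vr vr0 lamlt] w Sw.
have p0 : 0 < p%:R :> R by rewrite ltr0n.
have lamE : lambda = M * (C * s) by rewrite /lambda; ring.
have plam : p%:R * (M * (C * s)) < 1.
  by rewrite -lamE mulrC -ltr_pdivlMr// (lt_trans lamlt)// ltrBlDr ltrDl.
have [ex err] := giss_estimator_error uS OT OM Sw plam rho1.
rewrite -lamE in ex err plam; split => // Om OmP.
apply: (le_trans (err _ OmP)).
have d0 : 0 < 1 - p%:R * lambda by rewrite subr_gt0.
have M0 : 0 <= M by apply: le_trans OM; rewrite /norm_L1; exact: bigmax_ge_id.
have lam0 : 0 <= lambda by rewrite lamE mulr_ge0// (le_trans _ Sw).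
(* Since [3 + (1 + 3 y) / (1 - y) = 4 / (1 - y)], the claimed bound is twice the one obtained. *)
have -> : C * (3 + (1 + 3 * p%:R * lambda) / (1 - p%:R * lambda)) * M ^+ 2 * s
    = 4 * M * lambda / (1 - p%:R * lambda).
  have -> : 3 + (1 + 3 * p%:R * lambda) / (1 - p%:R * lambda)
      = 4 / (1 - p%:R * lambda) by field; rewrite gt_eqF.
  have -> : 4 * M * lambda = C * 4 * M ^+ 2 * s by rewrite lamE; ring.
  by ring.
by rewrite ler_wpM2r ?invr_ge0 ?(ltW d0)// ler_wpM2r// ler_wpM2r// ler_nat.
Qed.

End Reduction.

Lemma sample_cov_rv_error (R : realType) d (T : measurableType d) n p
    (Xs : 'I_n -> T -> p.-tuple R) (w : T) (mu : 'I_p -> R) (Sigma : 'M[R]_p)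
    (al be si : R) : (2 <= n)%N ->
  (forall i j, `|n%:R^-1 * (\sum_k centered mu i (Xs k w)
                              * centered mu j (Xs k w)) - Sigma i j| <= al) ->
  (forall i, `|n%:R^-1 * (\sum_k centered mu i (Xs k w))| <= be) ->
  (forall i j, `|Sigma i j| <= si) -> 0 <= al -> 0 <= be -> 0 <= si ->
  `|sample_cov_rv Xs w - Sigma|
    <= (1 + n.-1%:R^-1) * (al + be ^+ 2) + n.-1%:R^-1 * si.
Proof.
move=> n2 Hal Hbe Hsi al0 be0 si0.
apply: (@sample_cov_error R n p _ mu n2 Sigma al be si) => // [i j|i].
  by under eq_bigr do rewrite !mxE; exact: Hal.
by under eq_bigr do rewrite mxE; exact: Hbe.
Qed.

Lemma invr_pred_le (R : realType) n : (2 <= n)%N -> n.-1%:R^-1 <= 2 / n%:R :> R.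
Proof.
case: n => [|[|n]]// _ /=.
rewrite ler_pdivlMr ?ltr0n// mulrC ler_pdivrMr ?ltr0n//.
by rewrite -natrM ler_nat mulSn mul1n addSn ltnS leq_addl.
Qed.

(** Follows from [exp(-1/2) >= 1/2]; it lets terms of order [1/n] be bounded by multiples of
    [ln p / n]. *)
Lemma ln_ge_half (R : realType) p : (2 <= p)%N -> 2^-1 <= ln p%:R :> R.
Proof.
move=> p2; have p0 : 0 < p%:R :> R by rewrite ltr0n ltnW.
rewrite -ler_expR lnK ?posrE// (@le_trans _ _ 2)// ?ler_nat//.
rewrite -[leRHS]invrK -[2^-1 in leLHS]opprK expRN lef_pV2 ?posrE ?expR_gt0//.
by apply: le_trans (expR_ge1Dx _); lra.
Qed.

Lemma expR_ln_powR (R : realType) (x a : R) : 0 < x -> expR (ln x * a) = x `^ a.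
Proof. by move=> x0; rewrite /powR gt_eqF// mulrC. Qed.

(** * Exponential-type tails *)

Section ExponentialTails.
Context {d : measure_display} {T : measurableType d} {R : realType}.
Variable P : probability T R.

(** The weight [exp(eta |f|)] is split into two factors [exp h], [h = eta |f| / 2]: one absorbs
    [h^2 / 2], the other [exp |v f|]. *)
Lemma expR_le_Taylor2_tail (eta u v f : R) : 0 < eta -> u <= eta / 2 ->
  `|v| = u ->
  expR (v * f) <= 1 + v * f + 4 * (u / eta) ^+ 2 * expR (eta * `|f|).
Proof.
move=> eta0 ue vu; apply: (le_trans (expR_le_Taylor2 _)); rewrite lerD2l.
have u0 : 0 <= u by rewrite -vu.
set h := eta * `|f| / 2.
have h0 : 0 <= h by rewrite divr_ge0// mulr_ge0// ltW.
have -> : eta * `|f| = h + h by rewrite /h; field.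
rewrite expRD mulrA; apply: ler_pM; rewrite ?divr_ge0 ?sqr_ge0 ?expR_ge0//.
  have h2 : h ^+ 2 / 2 <= expR h by have := expR_ge1Dx2 h0; lra.
  have -> : (v * f) ^+ 2 / 2 = 4 * (u / eta) ^+ 2 * (h ^+ 2 / 2).
    rewrite -(@real_normK _ (v * f)) ?num_real// normrM vu /h.
    by field; rewrite gt_eqF.
  by rewrite ler_wpM2l// mulr_ge0// sqr_ge0.
rewrite ler_expR normrM vu /h mulrAC ler_wpM2r//.
Qed.

Variables (n p : nat) (X : {RV P >-> p.-tuple R}).
Variables (mu : 'I_p -> R) (Sigma : 'M[R]_p) (eta K : R).
Hypothesis XmS : has_mean_cov P X mu Sigma.
Hypothesis eta_bounds : 0 < eta < 1 / 4.
Hypothesis tails : forall i : 'I_p,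
  mean_le P (fun w => expR (eta * centered mu i (X w) ^+ 2)) K.

Let Y i w := centered mu i (X w).

Let mY i : measurable_fun setT (Y i).
Proof. exact: measurable_centered_rv. Qed.

Let eta0 : 0 < eta. Proof. by case/andP: eta_bounds. Qed.

(** Combines [|a b| <= (a^2 + b^2) / 2] with the inequality of arithmetic and geometric means for
    the two exponentials. *)
Lemma mean_expR_mul i j :
  mean_le P (fun w => expR (eta * `|Y i w * Y j w|)) K.
Proof.
have h : mean_le P (fun w => 2^-1 * (expR (eta * Y i w ^+ 2) +
    expR (eta * Y j w ^+ 2))) (2^-1 * (K + K)).
  by apply: mean_leZ; [rewrite invr_ge0|apply: mean_leD; exact: tails].
apply: mean_le_trans h; last by lra.
  apply: (measurableT_comp (@measurable_expR R)); apply: measurable_funM => //.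
  by apply: measurableT_comp => //; exact: measurable_funM.
move=> w; rewrite expR_ge0/=; set a := Y i w; set b := Y j w.
set A := expR (eta * a ^+ 2 / 2); set B := expR (eta * b ^+ 2 / 2).
have -> : expR (eta * a ^+ 2) = A ^+ 2.
  by rewrite /A [RHS]expr2 -expRD; congr expR; field.
have -> : expR (eta * b ^+ 2) = B ^+ 2.
  by rewrite /B [RHS]expr2 -expRD; congr expR; field.
apply: (@le_trans _ _ (A * B)); last by have := sqr_ge0 (A - B); lra.
rewrite /A /B -expRD ler_expR -mulrDl -mulrDr -mulrA ler_pM2l//.
rewrite normrM -(real_normK (num_real a)) -(real_normK (num_real b)).
have := sqr_ge0 (`|a| - `|b|); lra.
Qed.

(** From [|a| <= 1 + a^2]; the factor 2 bounds [exp(1/2)], hence [exp eta]. *)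
Lemma mean_expR_norm i : mean_le P (fun w => expR (eta * `|Y i w|)) (2 * K).
Proof.
have h : mean_le P (fun w => 2 * expR (eta * Y i w ^+ 2)) (2 * K).
  by apply: mean_leZ => //; exact: tails.
apply: mean_le_trans h => //.
  apply: (measurableT_comp (@measurable_expR R)); apply: measurable_funM => //.
  exact: measurableT_comp.
move=> w; rewrite expR_ge0/=; set a := Y i w.
have e2 : expR (2^-1) <= 2 :> R.
  rewrite -[leRHS]invrK -[2^-1 in leLHS]opprK expRN lef_pV2 ?posrE ?expR_gt0//.
  by apply: le_trans (expR_ge1Dx _); lra.
apply: (@le_trans _ _ (expR 2^-1 * expR (eta * a ^+ 2))); last first.
  by rewrite ler_wpM2r ?expR_ge0.
rewrite -expRD ler_expR.
have /andP[_ e4] := eta_bounds.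
have na : `|a| <= 1 + a ^+ 2.
  rewrite -(real_normK (num_real a)); have := sqr_ge0 (`|a| - 1); have := normr_ge0 a; lra.
have : eta * `|a| <= eta * (1 + a ^+ 2) by rewrite ler_pM2l.
lra.
Qed.

Lemma cov_le_tail i j : `|Sigma i j| <= K / eta.
Proof.
apply: (@norm_integral_le _ _ _ P (fun w => Y i w * Y j w)
   (fun w => eta^-1 * expR (eta * `|Y i w * Y j w|)) (Sigma i j)).
- exact: measurable_funM.
- move=> w; rewrite ler_pdivlMl//.
  by apply: le_trans (expR_ge1Dx _); rewrite lerDr.
- by rewrite mulrC; apply: mean_leZ; [rewrite invr_ge0 ltW|exact: mean_expR_mul].
- exact: centered_mul_mean.
Qed.

Hypothesis n2 : (2 <= n)%N.
Hypothesis p2 : (2 <= p)%N.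
Hypothesis lnp : ln p%:R / n%:R <= eta.
Variable Xs : 'I_n -> {RV P >-> p.-tuple R}.
Hypothesis iid : iid_samples X Xs.

Let s : R := Num.sqrt (ln p%:R / n%:R).

Let L0 : 0 <= ln (p%:R : R).
Proof. by rewrite ln_ge0// ler1n ltnW. Qed.

Let s2 : s ^+ 2 = ln p%:R / n%:R. Proof. by rewrite sqr_sqrtr// divr_ge0. Qed.

Let s0 : 0 <= s. Proof. exact: sqrtr_ge0. Qed.

Let s_half : s <= 2^-1.
Proof.
have /andP[_ e4] := eta_bounds.
rewrite -(@ler_pXn2r _ 2)// ?nnegrE// s2 (le_trans lnp)//.
by apply: ltW; apply: (lt_le_trans e4); rewrite expr2; lra.
Qed.

Let ns2 : n%:R * s ^+ 2 = ln p%:R.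
Proof. by rewrite s2 mulrC divfK// pnatr_eq0 -lt0n ltnW. Qed.

(** Chernoff's bound with exponent [eta s], where [s <= 1/2] keeps it below [eta / 2]. As
    [n s^2 = ln p], the second-order cost is [4 c ln p] and the gain [a ln p]. *)
Lemma average_tail (f : p.-tuple R -> R) (m c a : R) :
  measurable_fun setT f -> P.-integrable setT (fun w => (f (X w))%:E) ->
  (\int[P]_w (f (X w))%:E = m%:E)%E ->
  mean_le P (fun w => expR (eta * `|f (X w)|)) c ->
  let A := [set w | a / eta * s <= `|n%:R^-1 * (\sum_k f (Xs k w)) - m|] in
  measurable A /\
  (P A <= (2 * expR (ln p%:R * (4 * c - a)))%:E)%E.
Proof.
move=> mf intf fm [_ _ fc] A.
have u0 : 0 <= eta * s by rewrite mulr_ge0// ltW.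
have := @iid_average_deviation _ _ _ P _ _ n X Xs f
  (fun y => 4 * s ^+ 2 * expR (eta * `|f y|)) m (eta * s) (4 * s ^+ 2 * c)
  (a / eta * s) (ltnW n2) iid mf.
have c4 : 0 <= 4 * s ^+ 2 by rewrite mulr_ge0// sqr_ge0.
have mef : measurable_fun setT (fun y => expR (eta * `|f y|)).
  apply: (measurableT_comp (@measurable_expR R)); apply: measurable_funM => //.
  exact: measurableT_comp.
have -> : n%:R * (4 * s ^+ 2 * c - eta * s * (a / eta * s))
    = ln p%:R * (4 * c - a).
  by rewrite -ns2; field; rewrite gt_eqF.
apply => //.
- exact: measurable_funM.
- by move=> y; rewrite mulr_ge0// expR_ge0.
- have [_ _] : mean_le P (fun w => 4 * s ^+ 2 * expR (eta * `|f (X w)|))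
    (4 * s ^+ 2 * c).
    by apply: mean_leZ => //; split => //; exact: (measurableT_comp mef).
  by [].
- move=> v y vu; have := @expR_le_Taylor2_tail eta (eta * s) v (f y) eta0 _ vu.
  have -> : eta * s / eta = s by field; rewrite gt_eqF.
  by apply; rewrite ler_pM2l.
Qed.

Let K1 : 1 <= K.
Proof.
have [_ _] : mean_le P (fun=> 1) K.
  apply: mean_le_trans (tails (Ordinal (ltnW p2))) => // w.
  by rewrite ler01 -expR0 ler_expR mulr_ge0 ?sqr_ge0// ltW.
by rewrite integral_cst//= probability_setT mule1.
Qed.

(** The [p^2 + p] bad events have probability at most [2 p^(-2-tau)] each, in total at most
    [4 p^(-tau)]. *)
Lemma exponential_tails_cov (tau : R) : 0 < tau ->
  let a := 2 + tau + eta^-1 * expR 2 * K ^+ 2 in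
  prob_at_least P (1 - 4 * p%:R `^ (- tau))
    [set w | `|sample_cov_rv Xs w - Sigma| <= 2 * eta ^- 2 * a ^+ 2 * s].
Proof.
move=> tau0 a.
have /andP[_ e4] := eta_bounds.
have ie4 : 4 <= eta^-1.
  by rewrite -[4]invrK lef_pV2 ?posrE ?invr_gt0// ltW//; move: e4; lra.
have KK : K <= K ^+ 2 by rewrite expr2 ler_peMl// (le_trans ler01).
have K0 : 0 <= K by exact: le_trans K1.
have e2 : 3 <= expR 2 :> R by apply: le_trans (expR_ge1Dx _); lra.
(* This margin covers the costs in [average_tail]: [4 K] for products and [8 K] for single
   coordinates. *)
have ia : 12 * K <= eta^-1 * expR 2 * K ^+ 2.
  apply: ler_pM => //.
  have -> : 12 = 4 * 3 :> R by ring.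
  exact: ler_pM.
have a12 : 2 + tau + 12 * K <= a by rewrite lerD2l.
have p0 : 0 < p%:R :> R by rewrite ltr0n ltnW.
pose x := a / eta * s.
pose A (k : ('I_p * 'I_p) + 'I_p) : set T := match k with
  | inl ij => [set w | x <= `|n%:R^-1 * (\sum_k centered mu ij.1 (Xs k w)
                * centered mu ij.2 (Xs k w)) - Sigma ij.1 ij.2|]
  | inr i => [set w | x <= `|n%:R^-1 * (\sum_k centered mu i (Xs k w)) - 0|]
  end.
pose b (k : ('I_p * 'I_p) + 'I_p) := 2 * p%:R ^- 2 * p%:R `^ (- tau).
have bP c : c <= 8 * K -> ((2 * expR (ln p%:R * (c - a)))%:E
    <= (2 * p%:R ^- 2 * p%:R `^ (- tau))%:E)%E.
  move=> cK; rewrite lee_fin -mulrA ler_wpM2l//.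
  have -> : p%:R ^- 2 * p%:R `^ (- tau) = expR (ln p%:R * (- 2 - tau)) :> R.
    rewrite expR_ln_powR// powRD; last by rewrite (gt_eqF p0) implybT.
    by rewrite (powRN _ 2) powR_mulrn// ltW.
  by rewrite ler_expR ler_wpM2l//; lra.
have mc i := measurable_centered mu i.
have AP k : measurable (A k) /\ (P (A k) <= (b k)%:E)%E.
  case: k => [[i j]|i] /=.
  - have [|mA PA] := @average_tail
      (fun y => centered mu i y * centered mu j y) (Sigma i j) K a
      _ (centered_mul_integrable XmS i j) (centered_mul_mean XmS i j)
      (mean_expR_mul i j).
      exact: measurable_funM.
    split => //; apply: (le_trans PA); apply: bP; lra.
  - have [mA PA] := average_tail a (mc i) (centered_integrable XmS i)
      (centered_mean XmS i) (mean_expR_norm i).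
    split => //; apply: (le_trans PA); apply: bP; lra.
apply: (@prob_at_least_union _ _ _ _ _ A b) => [k|k||w wA].
- by have [] := AP k.
- by have [] := AP k.
- rewrite lerD2l lerN2 sumr_const card_sum card_prod !card_ord.
  rewrite -[_ *+ _]mulr_natl natrD natrM.
  set e := p%:R `^ (- tau).
  have e0 : 0 <= e by exact: powR_ge0.
  have -> : (p%:R * p%:R + p%:R) * (2 * p%:R ^- 2 * e)
      = (2 + 2 / p%:R) * e :> R by field; rewrite gt_eqF.
  rewrite ler_wpM2r//.
  have : p%:R^-1 <= 1 :> R by rewrite invf_le1// ler1n ltnW.
  lra.
have a0 : 0 <= a by lra.
have x0 : 0 <= x by rewrite mulr_ge0// divr_ge0// ltW.
have Hij i j : `|n%:R^-1 * (\sum_k centered mu i (Xs k w)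
    * centered mu j (Xs k w)) - Sigma i j| <= x.
  by apply/ltW; rewrite ltNge; apply/negP; exact: (wA (inl (i, j))).
have Hi i : `|n%:R^-1 * (\sum_k centered mu i (Xs k w))| <= x.
  apply/ltW; rewrite ltNge; apply/negP => h; apply: (wA (inr i)).
  by rewrite /= subr0.
have Ke : 0 <= K / eta by rewrite divr_ge0// ltW.
apply: (le_trans (sample_cov_rv_error n2 Hij Hi cov_le_tail x0 x0 Ke)).
set N := n.-1%:R^-1; have N0 : 0 <= N by rewrite invr_ge0.
have n0 : 0 < n%:R :> R by rewrite ltr0n ltnW.
(* [N <= 2/n <= 4 s^2] by [ln p >= 1/2], and [s <= 1/2]. *)
have N2s : N <= 2 * s.
  have h : 2 / n%:R <= 4 * s ^+ 2 :> R.
    by rewrite ler_pdivrMr// -mulrA (mulrC (s ^+ 2)) ns2; have := ln_ge_half R p2; lra.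
  have h2 : s ^+ 2 <= 2^-1 * s by rewrite expr2 ler_wpM2r.
  by have := invr_pred_le R n2; rewrite -/N; lra.
have N1 : N <= 1.
  have : 2 / n%:R <= 1 :> R by rewrite ler_pdivrMr// mul1r ler_nat.
  by have := invr_pred_le R n2; rewrite -/N; lra.
(* With [x = B s] the error is at most [2 (x + x^2) + 2 s B = 4 B s + 2 x^2]. Here [B >= 8] gives
   [4 B s <= B^2 s / 2], and [2 x^2 <= B^2 s]; the target is [2 B^2 s]. *)
set B := a / eta.
have xE : x = B * s by [].
have B8 : 8 <= B by rewrite /B; have : 2 * 4 <= a * eta^-1; [apply: ler_pM => //; lra|lra].
have KB : K / eta <= B.
  by rewrite /B ler_wpM2r ?invr_ge0 ?(ltW eta0)//; lra.
have -> : 2 * eta ^- 2 * a ^+ 2 * s = 2 * B ^+ 2 * s.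
  by rewrite /B; field; rewrite gt_eqF.
have x2 : x ^+ 2 <= 2^-1 * (B ^+ 2 * s).
  have -> : x ^+ 2 = B ^+ 2 * s ^+ 2 by rewrite xE exprMn.
  rewrite [leRHS]mulrCA; apply: ler_wpM2l; first exact: sqr_ge0.
  by rewrite expr2 ler_wpM2r.
have BB : 8 * (B * s) <= B ^+ 2 * s.
  by rewrite mulrA expr2 ler_wpM2r// ler_wpM2r//; lra.
have y0 : 0 <= x + x ^+ 2 by rewrite addr_ge0// sqr_ge0.
have h1 : (1 + N) * (x + x ^+ 2) <= 2 * (x + x ^+ 2).
  by rewrite ler_wpM2r//; lra.
have h2 : N * (K / eta) <= 2 * s * B by apply: ler_pM.
move: h1 h2 x2; rewrite xE; lra.
Qed.

End ExponentialTails.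

(** * Polynomial-type tails *)

Section PowerMoments.
Variables (R : realType) (m b : R).
Hypothesis m2 : 2 <= m.
Hypothesis b1 : 1 <= b.

Let b0 : 0 < b. Proof. exact: lt_le_trans b1. Qed.

Lemma ler1D_powR (z : R) : 0 <= z -> z <= 1 + z `^ m.
Proof.
move=> z0; have [z1|z1] := leP z 1; first by rewrite ler_wpDr// powR_ge0.
rewrite ler_wpDl// -{1}(powRr1 z0) ler_powR ?(ltW z1)//; apply: le_trans m2.
by rewrite ler1n.
Qed.

Lemma ler1D_powR2 (z : R) : 0 <= z -> z ^+ 2 <= 1 + z `^ m.
Proof.
move=> z0; have [z1|z1] := leP z 1.
  by rewrite ler_wpDr ?powR_ge0// exprn_ile1.
by rewrite ler_wpDl// -(powR_mulrn _ z0) ler_powR ?(ltW z1).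
Qed.

(** Above the level [b], [(z/b)^(m-1) >= 1]; this converts the truncated part into a moment with a
    small factor and so bounds the truncation bias. *)
Lemma powR_tail_le (z : R) : b < z -> z <= b `^ (1 - m) * z `^ m.
Proof.
move=> bz; have z0 : 0 < z by exact: lt_trans bz.
have -> : z `^ m = z `^ (m - 1) * z.
  rewrite -{3}(powRr1 (ltW z0)) -powRD ?subrK//.
  by rewrite (gt_eqF z0) implybT.
rewrite -opprB powRN ler_pdivlMl ?powR_gt0// ler_wpM2r ?(ltW z0)//.
rewrite ge0_ler_powR ?nnegrE ?(ltW b0) ?(ltW z0) ?(ltW bz)//.
by have := m2; lra.
Qed.

Lemma powR_tail_ge1 (z : R) : b < z -> 1 <= b `^ (- m) * z `^ m.
Proof.
move=> bz; have z0 : 0 < z by exact: lt_trans bz.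
rewrite powRN ler_pdivlMl ?powR_gt0// mulr1.
rewrite ge0_ler_powR ?nnegrE ?(ltW b0) ?(ltW z0) ?(ltW bz)//.
by have := m2; lra.
Qed.

End PowerMoments.

(** * Truncated coordinates and their deviations *)

Section PolynomialTails.
Context {d : measure_display} {T : measurableType d} {R : realType}.
Variable P : probability T R.
Variables (n p : nat) (X : {RV P >-> p.-tuple R}).
Variables (mu : 'I_p -> R) (Sigma : 'M[R]_p) (m b K : R).
Hypothesis XmS : has_mean_cov P X mu Sigma.
Hypothesis m2 : 2 <= m.
Hypothesis b1 : 1 <= b.

Let c (i : 'I_p) (y : p.-tuple R) : R := centered mu i y.
Let q (i : 'I_p) (y : p.-tuple R) : R := (c i y ^+ 2) `^ m.

Hypothesis tails : forall i : 'I_p, mean_le P (fun w => q i (X w)) K.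

Let S := 1 + K.
Let beta := b `^ (1 - m).

Let mc i : measurable_fun setT (c i). Proof. exact: measurable_centered. Qed.

Let mcX i : measurable_fun setT (fun w => c i (X w)).
Proof. exact: measurable_centered_rv. Qed.

Let mq i : measurable_fun setT (q i).
Proof.
apply: (measurableT_comp (measurable_powR m)); exact: measurable_funX.
Qed.

Let q0 i y : 0 <= q i y. Proof. exact: powR_ge0. Qed.

Let beta0 : 0 <= beta. Proof. exact: powR_ge0. Qed.

Lemma mean_sq i : mean_le P (fun w => c i (X w) ^+ 2) S.
Proof.
apply: mean_le_trans (mean_leD (mean_le_cst P ler01) (tails i)) => //.
  exact: measurable_funX.
by move=> w; rewrite sqr_ge0 ler1D_powR// sqr_ge0.
Qed.

Lemma mean_pow4 i : mean_le P (fun w => (c i (X w) ^+ 2) ^+ 2) S.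
Proof.
apply: mean_le_trans (mean_leD (mean_le_cst P ler01) (tails i)) => //.
  by apply: measurable_funX; exact: measurable_funX.
by move=> w; rewrite sqr_ge0 ler1D_powR2// sqr_ge0.
Qed.

Let K0 (i : 'I_p) : 0 <= K. Proof. exact: mean_le_ge0 (tails i). Qed.

Lemma normM_le_sq (x y : R) : `|x * y| <= 2^-1 * (x ^+ 2 + y ^+ 2).
Proof.
rewrite normrM -(real_normK (num_real x)) -(real_normK (num_real y)).
have := sqr_ge0 (`|x| - `|y|); lra.
Qed.

Lemma cov_le_moment i j : `|Sigma i j| <= S.
Proof.
have h : mean_le P (fun w => 2^-1 * (c i (X w) ^+ 2 + c j (X w) ^+ 2)) S.
  apply: (@mean_le_trans _ _ _ P _ _ (2^-1 * (S + S)))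
    (mean_leZ _ (mean_leD (mean_sq i) (mean_sq j))) => //.
  - by apply: measurable_funM => //; apply: measurable_funD; exact: measurable_funX.
  - by move=> w; rewrite lexx andbT mulr_ge0// addr_ge0// sqr_ge0.
  - lra.
apply: norm_integral_le h (centered_mul_mean XmS i j).
  exact: measurable_funM.
by move=> w; exact: normM_le_sq.
Qed.

Let Z i j y := c i y * c j y - Sigma i j.

Let mZ i j : measurable_fun setT (Z i j).
Proof. by apply: measurable_funB => //; exact: measurable_funM. Qed.

Let mZX i j : measurable_fun setT (fun w => Z i j (X w)).
Proof. exact: (measurableT_comp (mZ i j)). Qed.

(** From [(a a' - sigma)^2 <= a^4 + a'^4 + 2 sigma^2]. This bounds [kappa] in terms of [K] alone. *)
Lemma mean_sq_centered_mul i j :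
  mean_le P (fun w => Z i j (X w) ^+ 2) (4 * S ^+ 2).
Proof.
have S1 : 1 <= S by rewrite lerDl (K0 i).
have h := mean_leD (mean_leD (mean_pow4 i) (mean_pow4 j))
   (mean_le_cst P (_ : 0 <= 2 * S ^+ 2)).
apply: mean_le_trans (h _); last by rewrite mulr_ge0// sqr_ge0.
- exact: measurable_funX.
- move=> w; rewrite sqr_ge0/= /Z; set a := c i (X w); set a' := c j (X w).
  have s2 : Sigma i j ^+ 2 <= S ^+ 2.
    rewrite -(real_normK (num_real (Sigma i j))) ler_pXn2r ?nnegrE//.
      exact: cov_le_moment.
    by rewrite (le_trans ler01).
  have := sqr_ge0 (a * a' + Sigma i j).
  have := sqr_ge0 (a ^+ 2 - a' ^+ 2).
  lra.
- have : S <= S ^+ 2 by rewrite expr2 ler_peMl// (le_trans ler01).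
  lra.
Qed.

Let kap := kappa P X mu Sigma.

(** The cruder bound [mean_sq_centered_mul] makes the integral finite, so [fine] in [kappa] loses
    nothing. *)
Lemma mean_sq_le_kappa i j : mean_le P (fun w => Z i j (X w) ^+ 2) kap.
Proof.
have [mZ2 Z20 Z2] := mean_sq_centered_mul i j.
split => //; rewrite -[leLHS]fineK; last first.
  rewrite ge0_fin_numE; last by apply: integral_ge0 => w _; rewrite lee_fin.
  by rewrite (le_lt_trans Z2)// ltry.
rewrite lee_fin /kap /kappa.
have := le_bigmax 0 (fun ij : 'I_p * 'I_p => fine 'E_P[(fun w =>
  ((rv_coord X ij.1 w - mu ij.1) * (rv_coord X ij.2 w - mu ij.2)
    - Sigma ij.1 ij.2) ^+ 2)%R]) (i, j).
by rewrite /= unlock.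
Qed.

Lemma kappa_bounds : 0 <= kap <= 4 * S ^+ 2.
Proof.
apply/andP; split; first exact: bigmax_ge_id.
apply: bigmax_le => [|[i j] _ /=]; first by rewrite mulr_ge0// sqr_ge0.
have [_ Z20 Z2] := mean_sq_centered_mul i j.
rewrite unlock -lee_fin fineK//.
rewrite ge0_fin_numE; last first.
  by apply: integral_ge0 => w _; rewrite lee_fin sqr_ge0.
by rewrite (le_lt_trans Z2)// ltry.
Qed.

Let chi i y : R := \1_[set y | c i y ^+ 2 <= b] y.

Let mchi i : measurable_fun setT (chi i).
Proof.
apply: measurable_indic; rewrite -[X in measurable X]setTI.
by apply: measurable_fun_le => //; exact: measurable_funX.
Qed.

Let chiP i y : chi i y = 1 /\ c i y ^+ 2 <= b \/ chi i y = 0 /\ b < c i y ^+ 2.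
Proof.
rewrite /chi indicE; have [h|h] := leP (c i y ^+ 2) b.
  by left; rewrite mem_set.
by right; rewrite memNset//= leNgt h.
Qed.

(** The product is centered before it is truncated: its second moment then stays below [kap], at the
    price of a small nonzero mean. *)
Let TT i j y := chi i y * chi j y * Z i j y.

Let mTT i j : measurable_fun setT (TT i j).
Proof. by apply: measurable_funM => //; exact: measurable_funM. Qed.

Let TT_le_sq i j y : TT i j y ^+ 2 <= Z i j y ^+ 2.
Proof.
rewrite /TT; case: (chiP i y) => -[-> _]; case: (chiP j y) => -[-> _];
  by rewrite ?mul1r ?mul0r ?mulr0 ?mul0r ?expr0n ?sqr_ge0.
Qed.

Let norm_TT_le i j y : `|TT i j y| <= b + S.
Proof.
have S0 : 0 <= S by rewrite addr_ge0// (K0 i).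
have bS : 0 <= b + S by rewrite addr_ge0// (le_trans _ b1).
rewrite /TT; case: (chiP i y) => -[-> ci]; case: (chiP j y) => -[-> cj];
  rewrite ?mul1r ?mul0r ?mulr0 ?mul0r ?normr0//.
apply: (le_trans (ler_normB _ _)); apply: lerD; last exact: cov_le_moment.
apply: (le_trans (normM_le_sq _ _)); lra.
Qed.

(** The two differ only if the larger square [x] exceeds [b]. Then [|Z| <= x + S <= (1 + S) x] since
    [x >= 1], and [x] is bounded by [powR_tail_le]. *)
Let TT_err i j y : `|TT i j y - Z i j y| <= (1 + S) * beta * (q i y + q j y).
Proof.
have S0 : 0 <= S by rewrite addr_ge0// (K0 i).
have r0 : 0 <= (1 + S) * beta * (q i y + q j y).
  by apply: mulr_ge0; [apply: mulr_ge0 => //; exact: addr_ge0|exact: addr_ge0].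
have key : b < Num.max (c i y ^+ 2) (c j y ^+ 2) ->
    `|Z i j y| <= (1 + S) * beta * (q i y + q j y).
  set x := Num.max _ _ => bx.
  have xq : x <= beta * (q i y + q j y).
    move: bx; rewrite /x maxEle; case: ifP => _ bx.
      by apply: (le_trans (powR_tail_le m2 b1 bx)); rewrite ler_wpM2l ?lerDr.
    by apply: (le_trans (powR_tail_le m2 b1 bx)); rewrite ler_wpM2l ?lerDl.
  have x1 : 1 <= x by rewrite (le_trans b1)// ltW.
  rewrite -mulrA; apply: (@le_trans _ _ ((1 + S) * x)); last first.
    by rewrite ler_wpM2l// addr_ge0.
  apply: (le_trans (ler_normB _ _)).
  have -> : (1 + S) * x = x + S * x by ring.
  apply: lerD.
    apply: (le_trans (normM_le_sq _ _)).
    have : c i y ^+ 2 <= x by rewrite /x le_max lexx.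
    have : c j y ^+ 2 <= x by rewrite /x le_max lexx orbT.
    lra.
  by apply: (le_trans (cov_le_moment i j)); rewrite ler_peMr.
rewrite /TT; case: (chiP i y) => -[-> ci]; case: (chiP j y) => -[-> cj];
  rewrite ?mul1r ?mul0r ?mulr0 ?mul0r ?subrr ?normr0// sub0r normrN; apply: key;
  by rewrite lt_max ?ci ?cj ?orbT.
Qed.

Let U i y := chi i y * c i y.

Let mU i : measurable_fun setT (U i).
Proof. exact: measurable_funM. Qed.

Let U_le_sq i y : U i y ^+ 2 <= c i y ^+ 2.
Proof. by rewrite /U; case: (chiP i y) => -[-> _]; rewrite ?mul1r ?mul0r ?expr0n
  ?sqr_ge0.
Qed.

Let norm_le_sq (x : R) : 1 <= x ^+ 2 -> `|x| <= x ^+ 2.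
Proof.
move=> x1; rewrite -(real_normK (num_real x)) expr2 ler_peMr//.
by rewrite -(@ler_pXn2r _ 2)// ?nnegrE// expr1n real_normK ?num_real.
Qed.

Let norm_U_le i y : `|U i y| <= b.
Proof.
rewrite /U; case: (chiP i y) => -[-> ci]; rewrite ?mul1r ?mul0r; last first.
  by rewrite normr0 (le_trans ler01).
have [x1|x1] := leP 1 (c i y ^+ 2); first exact: le_trans (norm_le_sq x1) ci.
apply: le_trans b1.
by rewrite -(@ler_pXn2r _ 2)// ?nnegrE// expr1n real_normK ?num_real// ltW.
Qed.

Let U_err i y : `|U i y - c i y| <= beta * q i y.
Proof.
rewrite /U; case: (chiP i y) => -[-> ci]; rewrite ?mul1r ?mul0r ?subrr ?normr0 ?mulr_ge0//.
rewrite sub0r normrN; apply: le_trans (powR_tail_le m2 b1 ci).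
by apply: norm_le_sq; rewrite (le_trans b1)// ltW.
Qed.

(** [f] is a bounded truncation of the mean-zero [g]; its mean is that of [f - g]. *)
Lemma truncated_mean (f g : p.-tuple R -> R) (B e : R) :
  measurable_fun setT f -> measurable_fun setT g -> 0 <= B ->
  (forall y, `|f y| <= B) -> P.-integrable setT (fun w => (g (X w))%:E) ->
  (\int[P]_w (g (X w))%:E = 0)%E ->
  (exists2 h, mean_le P (fun w => h (X w)) e & forall y, `|f y - g y| <= h y) ->
  P.-integrable setT (fun w => (f (X w))%:E) /\
  exists2 mf, (\int[P]_w (f (X w))%:E = mf%:E)%E & `|mf| <= e.
Proof.
move=> mf mg B0 fB intg g0 [h he fh].
have mfX : measurable_fun setT (fun w => f (X w)) by exact: (measurableT_comp mf).
have mgX : measurable_fun setT (fun w => g (X w)) by exact: (measurableT_comp mg).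
have intf : P.-integrable setT (fun w => (f (X w))%:E).
  by apply: (@mean_le_integrable _ _ _ P _ (cst B) B) => //; exact: mean_le_cst.
split => //; exists (fine (\int[P]_w (f (X w))%:E)%E).
  by rewrite fineK// integrable_fin_num.
apply: (@norm_integral_le _ _ _ P (fun w => f (X w) - g (X w)) _ _ _ _ _ he) => //.
  exact: measurable_funB.
under eq_integral do rewrite EFinB.
by rewrite integralB// g0 sube0 fineK// integrable_fin_num.
Qed.

Hypothesis n2 : (2 <= n)%N.
Hypothesis p2 : (2 <= p)%N.
Variable Xs : 'I_n -> {RV P >-> p.-tuple R}.
Hypothesis iid : iid_samples X Xs.
Variable tau : R.
Hypothesis tau0 : 0 < tau.

Let s : R := Num.sqrt (ln p%:R / n%:R).
Let x : R := Num.sqrt ((4 + tau) * (kap + 1)) * s.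

Hypothesis xb : x * (b + S) <= 1.
Hypothesis sb : s * b <= 1.

Let L0 : 0 <= ln (p%:R : R).
Proof. by rewrite ln_ge0// ler1n ltnW. Qed.

Let s0 : 0 <= s. Proof. exact: sqrtr_ge0. Qed.

Let ns2 : n%:R * s ^+ 2 = ln p%:R.
Proof.
by rewrite sqr_sqrtr ?divr_ge0// mulrC divfK// pnatr_eq0 -lt0n ltnW.
Qed.

Let kap0 : 0 <= kap. Proof. by case/andP: kappa_bounds. Qed.

Let x0 : 0 <= x. Proof. by rewrite mulr_ge0// sqrtr_ge0. Qed.

Let x2E : x ^+ 2 = (4 + tau) * (kap + 1) * s ^+ 2.
Proof. by rewrite exprMn sqr_sqrtr// mulr_ge0// addr_ge0// ltW. Qed.

Let i0 : 'I_p := Ordinal (ltnW p2).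

Let KK0 : 0 <= K. Proof. exact: K0 i0. Qed.

Let S0 : 0 <= S. Proof. by rewrite addr_ge0. Qed.

Lemma expR_le_Taylor2_bounded (v u f F B : R) : `|v| = u -> `|f| <= B ->
  f ^+ 2 <= F -> expR (v * f) <= 1 + v * f + u ^+ 2 / 2 * expR (u * B) * F.
Proof.
move=> vu fB fF; apply: (le_trans (expR_le_Taylor2 _)); rewrite lerD2l.
have u0 : 0 <= u by rewrite -vu.
have -> : (v * f) ^+ 2 / 2 = u ^+ 2 / 2 * f ^+ 2.
  by rewrite exprMn -(real_normK (num_real v)) vu; ring.
have u2 : 0 <= u ^+ 2 / 2 by rewrite divr_ge0// sqr_ge0.
rewrite mulrAC; apply: ler_pM; rewrite ?sqr_ge0//.
  by apply: mulr_ge0; rewrite ?expR_ge0.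
by rewrite ler_wpM2l// ler_expR normrM vu ler_wpM2l.
Qed.

Lemma truncated_product_tail i j : exists2 mT,
  `|mT| <= 2 * (1 + S) * beta * K &
  let A := [set w | x <= `|n%:R^-1 * (\sum_k TT i j (Xs k w)) - mT|] in
  measurable A /\ (P A <= (2 * expR (ln p%:R * (- 2 - tau / 2)))%:E)%E.
Proof.
have bS0 : 0 <= b + S by rewrite addr_ge0// (le_trans _ b1).
have [| | |intT [mT TmT mTe]] := @truncated_mean (TT i j) (Z i j) (b + S)
    ((1 + S) * beta * (K + K)) (mTT i j) (mZ i j) bS0 (norm_TT_le i j) _ _ _.
- rewrite /Z; under eq_fun do rewrite EFinB.
  apply: integrableB => //; first exact: centered_mul_integrable XmS i j.
  exact: finite_measure_integrable_cst.
- rewrite /Z; under eq_integral do rewrite EFinB.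
  rewrite integralB//=; [|exact: centered_mul_integrable XmS i j|
    exact: finite_measure_integrable_cst].
  rewrite (centered_mul_mean XmS i j) integral_cst//= probability_setT mule1.
  by rewrite subee.
- exists (fun y => (1 + S) * beta * (q i y + q j y)); last exact: TT_err.
  by apply: mean_leZ (mean_leD (tails i) (tails j)); rewrite mulr_ge0// addr_ge0.
exists mT; first by apply: (le_trans mTe); lra.
have kap1 : 0 < kap + 1 by rewrite ltr_wpDl.
(* The minimizer of [t^2 (kap + 1) / 2 - t x]. *)
pose t := x / (kap + 1).
have t0 : 0 <= t by rewrite divr_ge0// ltW.
pose g := t ^+ 2 / 2 * expR (t * (b + S)) * kap.
have c0 : 0 <= t ^+ 2 / 2 * expR (t * (b + S)).
  by rewrite mulr_ge0 ?expR_ge0// divr_ge0// sqr_ge0.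
have [_ _ Eg] := mean_leZ c0 (mean_sq_le_kappa i j).
have [| |v y vt|mA PA] := @iid_average_deviation _ _ _ P _ _ n X Xs (TT i j)
  (fun y => t ^+ 2 / 2 * expR (t * (b + S)) * Z i j y ^+ 2) mT t g x
  (ltnW n2) iid (mTT i j) _ _ intT TmT Eg t0 _.
- by apply: measurable_funM => //; exact: measurable_funX.
- by move=> y; rewrite mulr_ge0// sqr_ge0.
- by apply: expR_le_Taylor2_bounded => //; exact: TT_le_sq.
split => //; apply: (le_trans PA).
rewrite lee_fin ler_wpM2l// ler_expR.
set y := t * (b + S).
have yk : (kap + 1) * y <= 1.
  by rewrite /y /t mulrA mulrCA divff ?mulr1// gt_eqF.
(* The extra 1 in [kap + 1] absorbs [exp y]: [(kap + 1) y <= 1] means [kap <= (kap + 1)(1 - y)], and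
   [(1 - y) exp y <= 1]. *)
have ek : kap * expR y <= kap + 1.
  have ey : (1 - y) * expR y <= 1.
    have := expR_ge1Dx (- y); rewrite expRN => h.
    by rewrite -ler_pdivlMr ?expR_gt0// mul1r.
  apply: (@le_trans _ _ ((kap + 1) * ((1 - y) * expR y))).
    by rewrite mulrA ler_wpM2r ?expR_ge0//; lra.
  by rewrite -[leRHS]mulr1 ler_wpM2l// ltW.
have gle : g <= t ^+ 2 / 2 * (kap + 1).
  by rewrite /g -mulrA (mulrC (expR _)) ler_wpM2l// divr_ge0// sqr_ge0.
(* The optimal value is [- x^2 / (2 (kap + 1))], that is [- (4 + tau) s^2 / 2]. *)
have E : n%:R * (t ^+ 2 / 2 * (kap + 1) - t * x) = ln p%:R * (- 2 - tau / 2).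
  rewrite -ns2 (_ : t ^+ 2 / 2 * (kap + 1) - t * x = - (x ^+ 2 / (2 * (kap + 1)))).
    by rewrite x2E; field; rewrite gt_eqF.
  by rewrite /t; field; rewrite gt_eqF.
by rewrite -E ler_wpM2l// lerD2r.
Qed.

(** The averages of coordinates enter the covariance error squared, so a threshold of order [s] with
    a rough constant suffices; the exponent is simply [s], with [exp(s b) <= exp 1 <= 4]. *)
Lemma truncated_coord_tail i : exists2 mU,
  `|mU| <= beta * K &
  let A := [set w | (2 + tau / 2 + 2 * S) * s <=
                    `|n%:R^-1 * (\sum_k U i (Xs k w)) - mU|] in
  measurable A /\ (P A <= (2 * expR (ln p%:R * (- 2 - tau / 2)))%:E)%E.
Proof.
have b0 : 0 <= b by rewrite (le_trans _ b1).
have [|intU [mU' UmU mUe]] := @truncated_mean (U i) (c i) b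
    (beta * K) (mU i) (mc i) b0 (norm_U_le i) (centered_integrable XmS i)
    (centered_mean XmS i) _.
  exists (fun y => beta * q i y); last exact: U_err.
  exact: mean_leZ (tails i).
exists mU' => //.
pose g := s ^+ 2 / 2 * expR (s * b) * S.
have c0 : 0 <= s ^+ 2 / 2 * expR (s * b).
  by rewrite mulr_ge0 ?expR_ge0// divr_ge0// sqr_ge0.
have [_ _ Eg] := mean_leZ c0 (mean_sq i).
have [| |v y vt|mA PA] := @iid_average_deviation _ _ _ P _ _ n X Xs (U i)
  (fun y => s ^+ 2 / 2 * expR (s * b) * c i y ^+ 2) mU' s g
  ((2 + tau / 2 + 2 * S) * s)
  (ltnW n2) iid (mU i) _ _ intU UmU Eg s0 _.
- by apply: measurable_funM => //; exact: measurable_funX.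
- by move=> y; rewrite mulr_ge0// sqr_ge0.
- by apply: expR_le_Taylor2_bounded => //; exact: U_le_sq.
split => //; apply: (le_trans PA).
rewrite lee_fin ler_wpM2l// ler_expR.
have e4 : expR (s * b) <= 4.
  apply: (@le_trans _ _ (expR 1)); first by rewrite ler_expR.
  have e2 : 2^-1 <= expR (- 2^-1) :> R by apply: le_trans (expR_ge1Dx _); lra.
  have -> : expR 1 = expR 2^-1 * expR 2^-1 :> R.
    by rewrite -expRD; congr expR; lra.
  have h : expR 2^-1 <= 2 :> R.
    by rewrite -[2^-1]opprK expRN -[leRHS]invrK lef_pV2 ?posrE ?expR_gt0.
  have -> : 4 = 2 * 2 :> R by ring.
  by apply: ler_pM; rewrite ?expR_ge0.
have gle : g <= 2 * S * s ^+ 2.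
  rewrite /g (_ : 2 * S * s ^+ 2 = s ^+ 2 / 2 * 4 * S); last by field.
  by rewrite ler_wpM2r// ler_wpM2l// divr_ge0// sqr_ge0.
rewrite -ns2 -mulrA ler_wpM2l//; move: gle; lra.
Qed.

Lemma coord_range_tail k i :
  let A := [set w | b < c i (Xs k w) ^+ 2] in
  measurable A /\ (P A <= (K * b `^ (- m))%:E)%E.
Proof.
move=> A; have mcs : measurable_fun setT (fun w => c i (Xs k w) ^+ 2).
  by apply: measurable_funX; exact: measurable_centered_rv.
have mA : measurable A.
  rewrite (_ : A = ~` [set w | c i (Xs k w) ^+ 2 <= b]).
    apply: measurableC; rewrite -[X in measurable X]setTI.
    exact: measurable_fun_le.
  by apply/seteqP; split => w; rewrite /A /= ltNge => /negP.
split => //; have bm0 : 0 <= b `^ (- m) by exact: powR_ge0.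
have [_ _ Eq] := mean_leZ bm0 (tails i).
rewrite mulrC; apply: le_trans Eq; rewrite -[P A]mul1e.
have mbq : measurable_fun setT (fun y => b `^ (- m) * q i y).
  exact: measurable_funM.
rewrite -(@ge0_integral_iid _ _ _ P _ _ n X Xs (fun y => b `^ (- m) * q i y) k)//.
  apply: (@le_measure_integral _ _ _ P A
    (fun w => b `^ (- m) * q i (Xs k w)) 1) => // [|w|w].
  - exact: (measurableT_comp mbq).
  - by rewrite mulr_ge0.
  - exact: powR_tail_ge1.
by move=> y; rewrite mulr_ge0.
Qed.

Let al := x + 2 * (1 + S) * beta * K.
Let be := (2 + tau / 2 + 2 * S) * s + beta * K.

(** The bad events are [p^2 + p] deviations of truncated averages and [n p] failures of the
    truncation. *)
Lemma polynomial_tails_cov (D : R) :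
  (1 + n.-1%:R^-1) * (al + be ^+ 2) + n.-1%:R^-1 * S <= D ->
  prob_at_least P
    (1 - (4 * p%:R `^ (- tau / 2) + n%:R * p%:R * (K * b `^ (- m))))
    [set w | `|sample_cov_rv Xs w - Sigma| <= D].
Proof.
move=> HD; have p0 : 0 < p%:R :> R by rewrite ltr0n ltnW.
have n0 : n%:R != 0 :> R by rewrite pnatr_eq0 -lt0n ltnW.
have /choice[mT mTP] : forall ij : 'I_p * 'I_p, exists mT,
    `|mT| <= 2 * (1 + S) * beta * K /\
    let A := [set w | x <= `|n%:R^-1 * (\sum_k TT ij.1 ij.2 (Xs k w)) - mT|] in
    measurable A /\ (P A <= (2 * expR (ln p%:R * (- 2 - tau / 2)))%:E)%E.
  by move=> ij; have [mT ? ?] := truncated_product_tail ij.1 ij.2; exists mT.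
have /choice[mV mVP] : forall i : 'I_p, exists mV,
    `|mV| <= beta * K /\
    let A := [set w | (2 + tau / 2 + 2 * S) * s <=
                      `|n%:R^-1 * (\sum_k U i (Xs k w)) - mV|] in
    measurable A /\ (P A <= (2 * expR (ln p%:R * (- 2 - tau / 2)))%:E)%E.
  by move=> i; have [mV ? ?] := truncated_coord_tail i; exists mV.
pose A (l : ('I_p * 'I_p + 'I_p) + 'I_n * 'I_p) : set T := match l with
  | inl (inl ij) => [set w | x <=
      `|n%:R^-1 * (\sum_k TT ij.1 ij.2 (Xs k w)) - mT ij|]
  | inl (inr i) => [set w | (2 + tau / 2 + 2 * S) * s <=
      `|n%:R^-1 * (\sum_k U i (Xs k w)) - mV i|]
  | inr ki => [set w | b < c ki.2 (Xs ki.1 w) ^+ 2]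
  end.
set e := p%:R `^ (- tau / 2).
pose B (l : ('I_p * 'I_p + 'I_p) + 'I_n * 'I_p) : R := match l with
  | inl _ => 2 * p%:R ^- 2 * e
  | inr _ => K * b `^ (- m)
  end.
have eE : expR (ln p%:R * (- 2 - tau / 2)) = p%:R ^- 2 * e.
  rewrite expR_ln_powR// powRD; last by rewrite (gt_eqF p0) implybT.
  by rewrite (powRN _ 2) powR_mulrn ?(ltW p0)// /e mulNr.
apply: (@prob_at_least_union _ _ _ _ _ A B) => [l|l||w wA].
- case: l => [[ij|i]|[k i]] /=.
  + by have [_ []] := mTP ij.
  + by have [_ []] := mVP i.
  + by have [] := coord_range_tail k i.
- case: l => [[ij|i]|[k i]] /=; rewrite /B -?mulrA -?eE.
  + by have [_ []] := mTP ij.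
  + by have [_ []] := mVP i.
  + by have [] := coord_range_tail k i.
- rewrite lerD2l lerN2 big_sumType/= !sumr_const card_sum !card_prod !card_ord.
  apply: lerD; last by rewrite -[_ *+ _]mulr_natl natrM.
  rewrite -[_ *+ _]mulr_natl natrD natrM.
  have e0 : 0 <= e by exact: powR_ge0.
  have -> : (p%:R * p%:R + p%:R) * (2 * p%:R ^- 2 * e)
      = (2 + 2 / p%:R) * e :> R by field; rewrite gt_eqF.
  rewrite ler_wpM2r//.
  have : p%:R^-1 <= 1 :> R by rewrite invf_le1// ler1n ltnW.
  lra.
(* No truncation occurs off the bad events, so truncated and original averages agree there. *)
have chi1 k i : chi i (Xs k w) = 1.
  have := wA (inr (k, i)); rewrite /A/= => /negP; rewrite -leNgt => h.
  by case: (chiP i (Xs k w)) => -[// _]; rewrite ltNge h.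
have Hij i j : `|n%:R^-1 * (\sum_k centered mu i (Xs k w)
    * centered mu j (Xs k w)) - Sigma i j| <= al.
  have := wA (inl (inl (i, j))); rewrite /A/= => /negP; rewrite -ltNge => h.
  have [mTe _] := mTP (i, j).
  have E : n%:R^-1 * (\sum_k TT i j (Xs k w))
    = n%:R^-1 * (\sum_k centered mu i (Xs k w) * centered mu j (Xs k w))
      - Sigma i j.
    under eq_bigr do rewrite /TT !chi1 !mul1r /Z.
    by rewrite sumrB sumr_const card_ord mulrBr -(mulr_natl (Sigma i j)) mulKf.
  rewrite -E -(subrK (mT (i, j)) (n%:R^-1 * _)).
  by apply: (le_trans (ler_normD _ _)); apply: lerD => //; exact: ltW.
have Hi i : `|n%:R^-1 * (\sum_k centered mu i (Xs k w))| <= be.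
  have := wA (inl (inr i)); rewrite /A/= => /negP; rewrite -ltNge => h.
  have [mVe _] := mVP i.
  have E : n%:R^-1 * (\sum_k U i (Xs k w))
    = n%:R^-1 * (\sum_k centered mu i (Xs k w)).
    by under eq_bigr do rewrite /U !chi1 !mul1r.
  rewrite -E -(subrK (mV i) (n%:R^-1 * _)).
  by apply: (le_trans (ler_normD _ _)); apply: lerD => //; exact: ltW.
have al0 : 0 <= al by exact: le_trans (Hij i0 i0).
have be0 : 0 <= be by exact: le_trans (Hi i0).
by apply: (le_trans (sample_cov_rv_error n2 Hij Hi _ al0 be0 S0)) => // i j;
  exact: cov_le_moment.
Qed.

End PolynomialTails.

(** * Rates in [n] under polynomial growth of [p] *)

Section PolynomialRates.
Variables (R : realType) (gam c1 delta K tau : R).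
Hypotheses (gam0 : 0 < gam) (c10 : 0 < c1) (delta0 : 0 < delta) (K0 : 0 <= K).
Hypothesis tau0 : 0 < tau.

Let S := 1 + K.
(** Half of the moment order [4 gam + 4 + delta]. The choice of [eps] gives [eps m = delta / 8], and
    [n^(- omega)] bounds the relative size of all lower order terms up to constants. *)
Let m := 2 * gam + 2 + delta / 2.
Let eps := delta / (8 * m).
Let omega := Num.min (eps / 2) gam.

Let m2 : 2 <= m.
Proof. by rewrite /m; have := gam0; have := delta0; lra. Qed.

Let m0 : 0 < m. Proof. exact: lt_le_trans m2. Qed.

Let eps0 : 0 < eps. Proof. by rewrite divr_gt0// mulr_gt0. Qed.

Let epsm : eps * m = delta / 8.
Proof. by rewrite /eps; field; rewrite gt_eqF. Qed.

Let eps4 : eps <= 4^-1.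
Proof.
rewrite /eps ler_pdivrMr ?mulr_gt0//.
by rewrite /m; have := gam0; have := delta0; lra.
Qed.

Let omega0 : 0 < omega.
Proof. by rewrite lt_min gam0 andbT divr_gt0. Qed.

Let A := `|ln c1| + gam / eps.
Let A' := Num.sqrt A.
Let Dm := Num.sqrt ((5 + tau) * (4 * S ^+ 2 + 1)).
Let a1 := 2 * (1 + S) * K.
Let c2 := 2 + tau / 2 + 2 * S.
Let c3 := c2 + 2 * K.
(** [g] is the room left for lower order terms, [Q] sums their coefficients, and [E] sums all
    smallness requirements, so that [E zeta <= 1] implies each of them. *)
Let g := Num.sqrt (5 + tau) - Num.sqrt (4 + tau).
Let Q := 4 * Dm + 4 * a1 + 2 * (c3 ^+ 2 * A') + 4 * S.
Let E := Dm * (1 + S) * A' + A' + Q / g + 1.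

Let S1 : 1 <= S. Proof. by rewrite lerDl. Qed.
Let S0 : 0 <= S. Proof. exact: le_trans S1. Qed.
Let A0 : 0 <= A. Proof. by rewrite addr_ge0// divr_ge0// ltW. Qed.
Let A'0 : 0 <= A'. Proof. exact: sqrtr_ge0. Qed.
Let Dm0 : 0 <= Dm. Proof. exact: sqrtr_ge0. Qed.
Let a10 : 0 <= a1. Proof. by rewrite !mulr_ge0// addr_ge0. Qed.
Let c20 : 0 <= c2. Proof. by rewrite /c2; have := tau0; have := S0; lra. Qed.
Let c30 : 0 <= c3. Proof. by rewrite addr_ge0// mulr_ge0. Qed.

Let g0 : 0 < g.
Proof. by rewrite subr_gt0 ltr_sqrt; have := tau0; lra. Qed.

Let Q0 : 0 <= Q.
Proof.
have := mulr_ge0 (sqr_ge0 c3) A'0.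
by rewrite /Q; have := Dm0; have := a10; have := S0; lra.
Qed.

Let E1 : 1 <= E.
Proof.
rewrite /E lerDr; apply: addr_ge0; last by rewrite divr_ge0// ltW.
by rewrite addr_ge0// !mulr_ge0// addr_ge0.
Qed.

(* When n^(delta/8) is below this constant, the claimed lower bound on the
   probability is nonpositive. *)
Definition rate_constant : R := E `^ (delta / (8 * omega)).

Variables (n p : nat).
Hypotheses (n2 : (2 <= n)%N) (p2 : (2 <= p)%N).
Hypothesis pn : p%:R <= c1 * n%:R `^ gam.

Let N : R := n%:R.
Let s : R := Num.sqrt (ln p%:R / N).
Let b := N `^ (2^-1 - eps).
Let zeta := N `^ (- omega).

Let N1 : 1 <= N. Proof. by rewrite ler1n ltnW. Qed.
Let N0 : 0 < N. Proof. exact: lt_le_trans N1. Qed.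
Let Nneq0 : N != 0. Proof. by rewrite gt_eqF. Qed.

Let NpD x y : N `^ (x + y) = N `^ x * N `^ y.
Proof. by rewrite powRD// Nneq0 implybT. Qed.

Let Nple x y : x <= y -> N `^ x <= N `^ y.
Proof. by move=> xy; rewrite ler_powR. Qed.

Let truncation_ge1 : 1 <= b.
Proof. by rewrite -(powRr0 N) Nple//; have := eps4; lra. Qed.

Let b0 : 0 < b. Proof. exact: lt_le_trans truncation_ge1. Qed.

Let zeta0 : 0 <= zeta. Proof. exact: powR_ge0. Qed.

(** The logarithm is traded for a small power: [eps ln N = ln(N^eps) <= N^eps]. *)
Let lnp_le : ln p%:R <= A * N `^ eps.
Proof.
have p0 : 0 < p%:R :> R by rewrite ltr0n ltnW.
have Ne1 : 1 <= N `^ eps by rewrite -(powRr0 N) Nple// ltW.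
have lnN : ln N <= N `^ eps / eps.
  rewrite ler_pdivlMr// mulrC -ln_powR.
  have := expR_ge1Dx (ln (N `^ eps)).
  by rewrite lnK ?posrE ?powR_gt0//; lra.
apply: (@le_trans _ _ (ln c1 + gam * ln N)).
  rewrite -ln_powR -lnM ?posrE ?powR_gt0//.
  by rewrite ler_ln ?posrE// mulr_gt0// powR_gt0.
rewrite /A mulrDl; apply: lerD.
  by apply: (le_trans (ler_norm _)); rewrite ler_peMr.
by rewrite mulrAC -mulrA ler_wpM2l// ltW.
Qed.

Let s0 : 0 <= s. Proof. exact: sqrtr_ge0. Qed.

Let s2 : s ^+ 2 = ln p%:R / N.
Proof. by rewrite sqr_sqrtr// divr_ge0 ?ln_ge0 ?ler1n ?ltW// ltnW. Qed.

(** [(s b)^2 = ln p N^(- 2 eps)], at most [A N^(- eps)] by [lnp_le]. *)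
Let sb_le : s * b <= A' * zeta.
Proof.
have h : s * b <= A' * N `^ (- (eps / 2)).
  have e0 : 0 < N `^ eps by exact: powR_gt0.
  rewrite -(@ler_pXn2r _ 2)// ?nnegrE; [|by rewrite mulr_ge0 ?powR_ge0..].
  rewrite !exprMn s2 sqr_sqrtr//.
  have -> : b ^+ 2 = N / (N `^ eps * N `^ eps).
    rewrite -powR_mulrn ?powR_ge0// -powRrM.
    have -> : (2^-1 - eps) * 2 = 1 + (- eps + - eps) by field.
    by rewrite !NpD powRr1 ?(ltW N0)// !powRN invfM.
  have -> : (N `^ (- (eps / 2))) ^+ 2 = (N `^ eps)^-1.
    by rewrite -powR_mulrn ?powR_ge0// -powRrM mulNr divfK// powRN.
  have -> : ln p%:R / N * (N / (N `^ eps * N `^ eps))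
      = ln p%:R / (N `^ eps) / (N `^ eps) by field; rewrite Nneq0 gt_eqF.
  by rewrite ler_wpM2r ?invr_ge0 ?(ltW e0)// ler_pdivrMr.
by apply: (le_trans h); rewrite ler_wpM2l// Nple// lerN2 ge_min lexx.
Qed.

Let s_le : s <= A' * zeta.
Proof. by apply: le_trans sb_le; rewrite ler_peMr// truncation_ge1. Qed.

Let rN_le : N `^ (- 2^-1) <= 2 * s.
Proof.
rewrite -(@ler_pXn2r _ 2)// ?nnegrE ?powR_ge0 ?mulr_ge0//.
rewrite -powR_mulrn ?powR_ge0// -powRrM mulNr mulVf// powR_inv1 ?(ltW N0)//.
rewrite exprMn s2 mulrA -[leLHS]mul1r ler_wpM2r ?invr_ge0 ?(ltW N0)//.
by have := ln_ge_half R p2; rewrite expr2; lra.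
Qed.

Let Ninv_le : N^-1 <= 2 * s * zeta.
Proof.
rewrite -powR_inv1 ?(ltW N0)// (_ : -1 = - 2^-1 + - 2^-1); last by lra.
rewrite NpD; apply: ler_pM; rewrite ?powR_ge0// Nple// lerN2 ge_min.
by apply/orP; left; have := eps4; lra.
Qed.

(** The exponent [(1/2 - eps)(1 - m)] equals [- 1/2 - gam - eps - delta/8]; the part [- 1/2] is paid
    by [2 s], and [- gam] by [zeta]. *)
Let beta_le : b `^ (1 - m) <= 2 * s * zeta.
Proof.
rewrite -powRrM; apply: (@le_trans _ _ (N `^ (- 2^-1 + - gam))).
  rewrite Nple//.
  have -> : (2^-1 - eps) * (1 - m) = 2^-1 - eps - 2^-1 * m + eps * m by ring.
  by rewrite epsm /m; have := eps0; have := delta0; lra.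
by rewrite NpD; apply: ler_pM; rewrite ?powR_ge0// Nple// lerN2 ge_min lexx orbT.
Qed.

(** The exponents balance exactly: [1 + gam - m/2 + eps m = - delta/8]. *)
Let range_tail_rate : N * p%:R * (K * b `^ (- m)) <= c1 * K * N `^ (- delta / 8).
Proof.
apply: (@le_trans _ _ (N * (c1 * N `^ gam) * (K * b `^ (- m)))).
  by rewrite ler_wpM2r ?mulr_ge0 ?powR_ge0// ler_wpM2l// ltW.
have -> : - delta / 8 = 1 + gam + (2^-1 - eps) * (- m).
  have -> : (2^-1 - eps) * (- m) = - (2^-1 * m) + eps * m by ring.
  by rewrite epsm /m; field.
rewrite !NpD powRr1 ?(ltW N0)// powRrM -/b.
by rewrite le_eqVlt; apply/orP; left; apply/eqP; ring.
Qed.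

Let rate_small :
  E * zeta <= 1 \/ 1 <= rate_constant * N `^ (- delta / 8).
Proof.
have [h|h] := leP (E * zeta) 1; [by left|right].
have NE : N `^ omega <= E.
  move: h; rewrite /zeta powRN ltr_pdivlMr ?powR_gt0// mul1r.
  exact: ltW.
rewrite /rate_constant mulNr powRN -ler_pdivrMr ?invr_gt0 ?powR_gt0// invrK mul1r.
have -> : delta / 8 = omega * (delta / (8 * omega)) by field; rewrite gt_eqF.
rewrite (powRrM N) ge0_ler_powR ?nnegrE ?powR_ge0//.
  by rewrite divr_ge0 ?(ltW delta0)// mulr_ge0// ltW.
exact: le_trans E1.
Qed.

Section SmallRate.
Variable kap : R.
Hypothesis kap_bounds : 0 <= kap <= 4 * S ^+ 2.
Hypothesis small : E * zeta <= 1.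

Let x := Num.sqrt ((4 + tau) * (kap + 1)) * s.

Let kap0 : 0 <= kap. Proof. by case/andP: kap_bounds. Qed.

Let sqrt_le_Dm : Num.sqrt ((4 + tau) * (kap + 1)) <= Dm.
Proof.
have /andP[_ k4] := kap_bounds.
have t0 := tau0; have k0 := kap0.
apply: ler_wsqrtr; apply: ler_pM; lra.
Qed.

Let part_small q : 0 <= q -> q <= E -> q * zeta <= 1.
Proof. by move=> q0 qE; apply: le_trans small; rewrite ler_wpM2r. Qed.

Let DSA0 : 0 <= Dm * (1 + S) * A'.
Proof. by rewrite !mulr_ge0// addr_ge0. Qed.

Let Qg0 : 0 <= Q / g. Proof. by rewrite divr_ge0// ltW. Qed.

Lemma truncation_small : x * (b + S) <= 1 /\ s * b <= 1.
Proof.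
split; last first.
  by apply: (le_trans sb_le); apply: part_small => //; rewrite /E;
     have := DSA0; have := Qg0; lra.
apply: (@le_trans _ _ (Dm * (1 + S) * A' * zeta)); last first.
  by apply: part_small => //; rewrite /E; have := A'0; have := Qg0; lra.
apply: (@le_trans _ _ (Dm * (1 + S) * (s * b))); last first.
  by rewrite -[leRHS]mulrA ler_wpM2l// mulr_ge0// addr_ge0.
have -> : Dm * (1 + S) * (s * b) = Dm * s * ((1 + S) * b) by ring.
have b1 := truncation_ge1.
apply: ler_pM.
- by rewrite mulr_ge0// sqrtr_ge0.
- by rewrite addr_ge0// ltW.
- by rewrite ler_wpM2r.
- by rewrite mulrDl mul1r lerD2l ler_peMr.
Qed.

(** The leading term is [x]; all others together are at most [Q s zeta <= g s], which fits into the
    gap between the two square roots since [kap + 1 >= 1]. *)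
Lemma deviation_rate :
  (1 + n.-1%:R^-1) * (x + 2 * (1 + S) * b `^ (1 - m) * K +
    (c2 * s + b `^ (1 - m) * K) ^+ 2) + n.-1%:R^-1 * S
  <= Num.sqrt ((5 + tau) * (kap + 1)) * s.
Proof.
have z1 : zeta <= 1 by rewrite -(powRr0 N) Nple// oppr_le0 ltW.
have As1 : A' * zeta <= 1.
  by apply: part_small => //; rewrite /E; have := DSA0; have := Qg0; lra.
have s1 : s <= 1 by exact: le_trans s_le As1.
set be := b `^ (1 - m).
have be0 : 0 <= be by exact: powR_ge0.
have sz0 : 0 <= s * zeta by exact: mulr_ge0.
set V := n.-1%:R^-1; have V0 : 0 <= V by rewrite invr_ge0.
have V1 : V <= 4 * (s * zeta).
  by have := invr_pred_le R n2; have := Ninv_le; rewrite -/V -/N; lra.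
have V1' : V <= 1.
  rewrite invf_le1// ?ltr0n ?ler1n -ltnS prednK// ltnW//.
have szz : s * zeta <= zeta by rewrite ler_piMl.
have xD : x <= Dm * s by rewrite ler_wpM2r.
have x0 : 0 <= x by rewrite mulr_ge0// sqrtr_ge0.
have Vx : V * x <= 4 * Dm * (s * zeta).
  have -> : 4 * Dm * (s * zeta) = (4 * zeta) * (Dm * s) by ring.
  apply: ler_pM => //; lra.
have bes : be * K <= 2 * K * s.
  have -> : 2 * K * s = 2 * s * K by ring.
  rewrite ler_wpM2r//; apply: (le_trans beta_le).
  by rewrite ler_piMr// mulr_ge0.
have c3s : (c2 * s + be * K) ^+ 2 <= c3 ^+ 2 * A' * (s * zeta).
  apply: (@le_trans _ _ ((c3 * s) ^+ 2)).
    rewrite ler_pXn2r ?nnegrE ?addr_ge0 ?mulr_ge0//.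
    have -> : c3 * s = c2 * s + 2 * K * s by rewrite /c3; ring.
    by rewrite lerD2l.
  rewrite exprMn -mulrA ler_wpM2l ?sqr_ge0//.
  by rewrite expr2 mulrCA ler_wpM2l.
have ab : 2 * (1 + S) * be * K <= 2 * a1 * (s * zeta).
  have -> : 2 * (1 + S) * be * K = a1 * be by rewrite /a1; ring.
  have -> : 2 * a1 * (s * zeta) = a1 * (2 * s * zeta) by ring.
  by rewrite ler_wpM2l.
have VS : V * S <= 4 * S * (s * zeta).
  have -> : 4 * S * (s * zeta) = 4 * (s * zeta) * S by ring.
  by rewrite ler_wpM2r.
have sum0 : 0 <= 2 * (1 + S) * be * K + (c2 * s + be * K) ^+ 2.
  by rewrite addr_ge0 ?sqr_ge0// !mulr_ge0// addr_ge0.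
have VV : V * (2 * (1 + S) * be * K + (c2 * s + be * K) ^+ 2)
    <= 2 * (1 + S) * be * K + (c2 * s + be * K) ^+ 2.
  by rewrite ler_piMl.
have tot : (1 + V) * (x + 2 * (1 + S) * be * K + (c2 * s + be * K) ^+ 2) + V * S
    <= x + Q * (s * zeta).
  by move: Vx c3s ab VS VV; rewrite /Q; lra.
apply: (le_trans tot).
have Qz : Q * zeta <= g.
  have -> : Q * zeta = g * (Q / g * zeta) by field; rewrite gt_eqF.
  rewrite -[leRHS]mulr1 ler_wpM2l ?(ltW g0)//.
  by apply: part_small => //; rewrite /E; have := DSA0; have := A'0; lra.
have t0 := tau0; have k0 := kap0.
have -> : Num.sqrt ((5 + tau) * (kap + 1)) =
  Num.sqrt (4 + tau) * Num.sqrt (kap + 1) + g * Num.sqrt (kap + 1).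
  by rewrite sqrtrM; [rewrite /g; ring|lra].
rewrite [leRHS]mulrDl; apply: lerD.
  by rewrite /x sqrtrM//; lra.
have -> : Q * (s * zeta) = Q * zeta * s by ring.
rewrite ler_wpM2r//; apply: (le_trans Qz); rewrite ler_peMr ?(ltW g0)//.
by rewrite -[leLHS]sqrtr1; apply: ler_wsqrtr; lra.
Qed.

End SmallRate.

Lemma polynomial_rates :
  1 <= rate_constant * N `^ (- delta / 8) \/
  [/\ 1 <= b,
      N * p%:R * (K * b `^ (- m)) <= c1 * K * N `^ (- delta / 8)
    & forall kap, 0 <= kap <= 4 * S ^+ 2 ->
      let x := Num.sqrt ((4 + tau) * (kap + 1)) * s in
      [/\ x * (b + S) <= 1, s * b <= 1
        & (1 + n.-1%:R^-1) * (x + 2 * (1 + S) * b `^ (1 - m) * K +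
            (c2 * s + b `^ (1 - m) * K) ^+ 2) + n.-1%:R^-1 * S
          <= Num.sqrt ((5 + tau) * (kap + 1)) * s]].
Proof.
have [small|] := rate_small; [right|by left].
split; [exact: truncation_ge1|exact: range_tail_rate|move=> kap kb x].
have [h1 h2] := truncation_small kb small.
by split => //; exact: deviation_rate.
Qed.

End PolynomialRates.

Section Assembly.
Context {d : measure_display} {T : measurableType d} {R : realType}.
Variable P : probability T R.

Lemma prob_at_least_sub (c c' : R) (G G' : set T) :
  c' <= c -> G `<=` G' -> prob_at_least P c G -> prob_at_least P c' G'.
Proof.
move=> cc GG [E [mE EG cE]]; exists E; split => //.
  exact: subset_trans GG.
by apply: le_trans cE; rewrite lee_fin.
Qed.

End Assembly.

Theorem theorem4p1 (R : realType) :
  (* (1) exponential-type tails *)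
  (forall (d : measure_display) (T : measurableType d) (P : probability T R)
      (n p : nat) (X : {RV P >-> p.-tuple R})
      (Xs : 'I_n -> {RV P >-> p.-tuple R})
      (mu : 'I_p -> R) (Sigma0 : 'M[R]_p) (q s0 M rho : R),
    giss_setting X Xs mu Sigma0 q s0 M rho ->
    forall eta K tau : R,
    0 < eta < 1 / 4%:R ->
    ln p%:R / n%:R <= eta ->
    (forall (i : 'I_p) (t : R), `|t| <= eta ->
      ('E_P[(fun w => expR (t * (rv_coord X i w - mu i) ^+ 2))%R] <= K%:E)%E) ->
    0 < tau ->
    let C0 := 2%:R * eta ^- 2 * (2%:R + tau + eta^-1 * expR 2%:R * K ^+ 2) ^+ 2 in
    let lambda := C0 * M * Num.sqrt (ln p%:R / n%:R) in
    (exists2 varrho : R, 0 < varrho & lambda < 1 / p%:R - varrho) ->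
    prob_at_least P (1 - 4%:R * p%:R `^ (- tau))
      (giss_within Xs rho lambda
        (C0 * (3%:R + (1 + 3%:R * p%:R * lambda) / (1 - p%:R * lambda))
            * M ^+ 2 * Num.sqrt (ln p%:R / n%:R))
        (invmx Sigma0)))
  /\
  (* (2) polynomial-type tails; the constant C of the O-term depends only on
     the constants gam, c1, delta, K and tau *)
  (forall gam c1 delta K tau : R,
    0 < gam -> 0 < c1 -> 0 < delta -> 0 < tau ->
    exists C : R,
    forall (d : measure_display) (T : measurableType d) (P : probability T R)
      (n p : nat) (X : {RV P >-> p.-tuple R})
      (Xs : 'I_n -> {RV P >-> p.-tuple R})
      (mu : 'I_p -> R) (Sigma0 : 'M[R]_p) (q s0 M rho : R),
    giss_setting X Xs mu Sigma0 q s0 M rho ->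
    p%:R <= c1 * n%:R `^ gam ->
    (forall i : 'I_p,
      ('E_P[(fun w => `|rv_coord X i w - mu i| `^ (4%:R * gam + 4%:R + delta))%R]
        <= K%:E)%E) ->
    let D0 := Num.sqrt ((5%:R + tau) * (kappa P X mu Sigma0 + 1)) in
    let lambda := D0 * M * Num.sqrt (ln p%:R / n%:R) in
    (exists2 varrho : R, 0 < varrho & lambda < 1 / p%:R - varrho) ->
    prob_at_least P
      (1 - C * (n%:R `^ (- delta / 8%:R) + p%:R `^ (- tau / 2%:R)))
      (giss_within Xs rho lambda
        (D0 * (3%:R + (1 + 3%:R * p%:R * lambda) / (1 - p%:R * lambda))
            * M ^+ 2 * Num.sqrt (ln p%:R / n%:R))
        (invmx Sigma0))).
Proof.
split.
  move=> d T P n p X Xs mu Sigma0 q s0 M rho setting eta K tau eta_b lnp tails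
    tau0 C0 lambda lamlt.
  have [n2 p1 XmS iid _ _ _ _] := setting.
  (* For [p = 1] the asserted probability is [1 - 4 <= 0]. *)
  have [p2|p2] := leqP 2 p; last first.
    apply: prob_at_least_le0.
    have -> : p = 1%N by apply/eqP; rewrite eqn_leq p1 andbT -ltnS.
    by rewrite powR1 mulr1 subr_le0 ler1n.
  have eta0 : 0 < eta by case/andP: eta_b.
  have tails' i : mean_le P (fun w => expR (eta * centered mu i (X w) ^+ 2)) K.
    split=> [|w|]; last 2 first.
    - exact: expR_ge0.
    - by have := tails i eta; rewrite ger0_norm ?(ltW eta0)// unlock; apply.
    apply: (measurableT_comp (@measurable_expR R)).
    apply: measurable_funM => //; apply: measurable_funX.
    exact: measurable_centered_rv.
  apply: prob_at_least_sub (exponential_tails_cov XmS eta_b tails' n2 p2 lnp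
    iid tau0) => // w Sw.
  exact: (giss_within_cov_near (C := C0) setting lamlt Sw).
move=> gam c1 delta K tau gam0 c10 delta0 tau0.
(* The constant is chosen before any random vector is given, when the sign of [K] is unknown. *)
pose K' := `|K|; have K0 : 0 <= K' by exact: normr_ge0.
pose C1 := rate_constant gam c1 delta K' tau.
have C10 : 0 <= C1 by exact: powR_ge0.
(* [C1] makes the bound trivial for small [n], [c1 K'] pays for truncation failures, and 4 for the
   deviations and the case [p = 1]. *)
exists (C1 + c1 * K' + 4).
move=> d T P n p X Xs mu Sigma0 q s0 M rho setting pn tails D0 lambda lamlt.
have [n2 p1 XmS iid _ _ _ _] := setting.
have nd0 : 0 <= n%:R `^ (- delta / 8) :> R by exact: powR_ge0.
have pt0 : 0 <= p%:R `^ (- tau / 2) :> R by exact: powR_ge0.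
have cK0 : 0 <= c1 * K' by rewrite mulr_ge0// ltW.
have [p2|p2] := leqP 2 p; last first.
  apply: prob_at_least_le0.
  have -> : p = 1%N by apply/eqP; rewrite eqn_leq p1 andbT -ltnS.
  rewrite powR1 subr_le0 mulrDr mulr1.
  by apply: ler_wpDl; [rewrite mulr_ge0 ?addr_ge0|lra].
have := polynomial_rates gam0 c10 delta0 K0 tau0 n2 p2 pn.
cbv zeta; rewrite -/C1; set b := n%:R `^ (2^-1 - _).
set m := 2 * gam + _ + _.
move=> [C1n|[b1 range rates]].
  apply: prob_at_least_le0; rewrite subr_le0; apply: (le_trans C1n).
  apply: ler_pM => //; last by rewrite lerDl.
  lra.
have m2 : 2 <= m by rewrite /m; lra.
have tails' i : mean_le P (fun w => (centered mu i (X w) ^+ 2) `^ m) K'.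
  have mc := measurable_centered_rv X mu i.
  split=> [|w|]; last 2 first.
  - exact: powR_ge0.
  - apply: (@le_trans _ _ K%:E); last by rewrite lee_fin ler_norm.
    apply: le_trans (tails i); rewrite unlock.
    rewrite le_eqVlt; apply/orP; left; apply/eqP.
    apply: eq_integral => w _; congr EFin.
    rewrite (_ : 4 * gam + 4 + delta = 2 * m); last by rewrite /m; field.
    by rewrite powRrM powR_mulrn// real_normK ?num_real.
  apply: (measurableT_comp (measurable_powR m)); exact: measurable_funX.
have /= [xb sb final] := rates _ (kappa_bounds XmS m2 tails').
apply: prob_at_least_sub (polynomial_tails_cov XmS m2 b1 tails' n2 p2 iid tau0
  xb sb final) => [|w Sw]; last first.
  exact: (giss_within_cov_near (C := D0) setting lamlt Sw).
rewrite lerD2l lerN2.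
apply: (@le_trans _ _ (4 * p%:R `^ (- tau / 2) + c1 * K' * n%:R `^ (- delta / 8))).
  by rewrite lerD2l.
have : 0 <= (C1 + c1 * K') * p%:R `^ (- tau / 2) by rewrite mulr_ge0// addr_ge0.
have : 0 <= (C1 + 4) * n%:R `^ (- delta / 8) by rewrite mulr_ge0// addr_ge0.
lra.
Qed.
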